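(* Let $R$ be an integral domain with field of fractions $k(\eta)$. Let $A$ be a graded $R$-algebra and let $M$ be a minimal $\mathrm{A}_\infty$-module over $A$ such that both $A$ and $M$ are finite projective as $R$-modules. Assume that the Hochschild cohomology group $\mathrm{HH}^{n,1-n}(A,M(2))$ is a torsion-free $R$-module for all $n$. If $M_\eta=k(\eta)\otimes_R M$ is formal (as an $\mathrm{A}_\infty$-module over $k(\eta)\otimes_R A$), then $M$ is formal and there exists a quasi-isomorphism $f: M\to M(2)$ of $\mathrm{A}_\infty$-modules over $A$ lifting the identity on the underlying complexes (i.e. $f_1=\mathrm{id}$). In particular, the fibres $M_{\mathfrak p}$ are formal for all $\mathfrak p\in\mathrm{Spec}(R)$.
   Context: $R$ is a commutative unital algebra over a field of characteristic $0$; tensor products are over $R$ and the Koszul sign rule is used. A graded (associative) $R$-algebra $A$ is regarded as an $\mathrm A_\infty$-algebra whose only non-zero structure map is the multiplication $m_2^A$ (so $m_k^A=0$ for $k\ne2$). An $\mathrm A_\infty$-module over $A$ is a graded $R$-module $M$ with $R$-linear maps $m_i^M:M\otimes A^{\otimes i-1}\to M$ of degree $2-i$, $i\ge1$, such that for all $m\ge1$ $$\sum_{j+k+l=m,\ j,k\ge1}(-1)^{jk+l}m^M_{j+1+l}(\mathrm{id}^{\otimes j}\otimes m^A_k\otimes\mathrm{id}^{\otimes l})+\sum_{k+l=m,\ k\ge 1}(-1)^l m^M_{1+l}(m^M_k\otimes\mathrm{id}^{\otimes l})=0.$$ It is minimal if $m_1^M=0$. A morphism $f:M\to N$ of $\mathrm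 A_\infty$-modules over $A$ is a family of $R$-linear maps $f_i:M\otimes A^{\otimes i-1}\to N$ of degree $1-i$, $i\ge1$, such that for all $m\ge1$ $$\sum_{j+k+l=m,\ k\ge1}(-1)^{jk+l}f_{j+1+l}(\mathrm{id}^{\otimes j}\otimes m_k\otimes\mathrm{id}^{\otimes l})=\sum_{r+s=m,\ r\ge1,\ s\ge0}m^N_{s+1}(f_r\otimes\mathrm{id}^{\otimes s}),$$ where on the left $m_k=m_k^M$ if $j=0$ and $m_k=m_k^A$ if $j\ge1$. It is a quasi-isomorphism if $f_1$ is a quasi-isomorphism of complexes. For a minimal $\mathrm A_\infty$-module $M$ over the graded algebra $A$, $M(2)$ denotes the $\mathrm A_\infty$-module on the same graded $R$-module with $m_2^{M(2)}=m_2^M$ and $m_i^{M(2)}=0$ for $i\ne2$ (i.e. the underlying graded $A$-module). $M$ is called formal if it is quasi-isomorphic to $M(2)$, i.e. there is a quasi-isomorphism $M(2)\to M$ of $\mathrm A_\infty$-modules over $A$. For a graded $A$-module $N$, the Hochschild complex is $C^{p,q}(A,N)=\mathrm{Hom}_R^q(N\otimes A^{\otimes p},N)$ ($R$-linear maps of degree $q$), with differential $\mathrm d:C^{p,q}\to C^{p+1,q}$, $$\mathrm d f=\sum_{j+l=p,\ j\ge1}(-1)^l f(\mathrm{id}^{\otimes j}\otimes m_2^A\otimes\mathrm{id}^{\otimes l})-m_2^N(f\otimes\mathrm{id})+(-1)^pf(m_2^N\otimes\mathrm{id}^{\otimes p}),$$ and $\mathrm{HH}^{p,q}(A,N)$ is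 the $p$-th cohomology of $(C^{*,q}(A,N),\mathrm d)$. For $\mathfrak p\in\mathrm{Spec}(R)$ with residue field $k(\mathfrak p)$, the fibre is $M_{\mathfrak p}=k(\mathfrak p)\otimes_RM$, an $\mathrm A_\infty$-module over $A_{\mathfrak p}=k(\mathfrak p)\otimes_RA$. *)

(* Defs.v *)
From HB Require Import structures.
From mathcomp Require Export all_boot all_order all_algebra.

Set Implicit Arguments.
Unset Strict Implicit.
Unset Printing Implicit Defensive.

Import Order.TTheory GRing.Theory Num.Theory.
Local Open Scope ring_scope.

(* A Z-graded module: a module V with submodules V_d, d : int, of which V is  *)
(* the internal direct sum; [homog d] is membership in V_d.                   *)
Record gradedModule (R : comNzRingType) := GradedModule {
  gm_mod :> lmodType R;
  homog : int -> gm_mod -> Prop;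
  homog0 : forall d, homog d 0;
  homogP : forall d (a : R) u v, homog d u -> homog d v -> homog d (a *: u + v);
  homog_span : forall v, exists (D : seq int) (w : int -> gm_mod),
    [/\ uniq D, forall d, homog d (w d) & v = \sum_(d <- D) w d];
  homog_indep : forall (D : seq int) (w : int -> gm_mod),
    uniq D -> (forall d, homog d (w d)) -> \sum_(d <- D) w d = 0 ->
    forall d, d \in D -> w d = 0
}.

(* Associative graded algebra; a unit is not required. *)
Record gradedAlgebra (R : comNzRingType) := GradedAlgebra {
  ga_mod :> gradedModule R;
  gmul : ga_mod -> ga_mod -> ga_mod;
  gmul_linearl : forall b, linear (gmul^~ b);
  gmul_linearr : forall a, linear (gmul a);
  gmulA : associative gmul;
  gmul_homog : forall d e a b,
    homog d a -> homog e b -> homog (d + e) (gmul a b)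
}.

Section Multilinear.

Variable R : comNzRingType.

Fixpoint homog_seq (V : gradedModule R) (ds : seq int) (s : seq V) : Prop :=
  match ds, s with
  | [::], [::] => True
  | d :: ds', a :: s' => homog d a /\ homog_seq ds' s'
  | _, _ => False
  end.

(* Linear maps out of M (x) A^(x p) are encoded as multilinear maps, and the  *)
(* tensor a_1 (x) ... (x) a_p as the list [:: a_1; ...; a_p]. A function      *)
(* f : M -> seq A -> N thus encodes a whole family of maps, one per p, and    *)
(* only its values on lists of size p matter for the p-th one.                *)
Definition multilinear (M N A : lmodType R) (p : nat) (f : M -> seq A -> N) :=
  (forall s, size s = p -> linear (f^~ s)) /\
  (forall x s t, (size s + size t).+1 = p -> linear (fun a => f x (s ++ a :: t))).

Definition has_degree (M N A : gradedModule R) (p : nat) (q : int)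
    (f : M -> seq A -> N) : Prop :=
  forall d ds x s, size s = p -> homog d x -> homog_seq ds s ->
    homog (d + \sum_(e <- ds) e + q) (f x s).

(* Hom_R^q(M (x) A^(x p), N) *)
Definition is_hom (M N A : gradedModule R) (p : nat) (q : int)
    (f : M -> seq A -> N) : Prop :=
  multilinear p f /\ has_degree p q f.

End Multilinear.

Section AInfinity.

Variables (R : comNzRingType) (A : gradedAlgebra R).

(* The operations m_k^A (k = size s) of the A-infinity algebra A. *)
Definition alg_op (s : seq A) : A :=
  if s is [:: a; b] then gmul a b else 0.

(* For j >= 1, (id^j (x) m_k^A (x) id^l)(x (x) s) = x (x) insert_op j.-1 k s. *)
(* There is no Koszul sign, since m_k^A <> 0 only for k = 2, when its degree  *)
(* 2 - k is 0.                                                                *)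
Definition insert_op (i k : nat) (s : seq A) : seq A :=
  take i s ++ alg_op (take k (drop i s)) :: drop (i + k) s.

(* The sum over j + k + l = m, k >= 1, of                                     *)
(*   (-1)^(jk+l) f_(j+1+l) (id^j (x) m_k (x) id^l)                            *)
(* evaluated at x (x) s, where m = size s + 1, m_k = m_k^M (here opM) in the  *)
(* terms j = 0 (first sum), and m_k = m_k^A in the terms j >= 1.              *)
Definition precomp (M N : lmodType R) (opM : M -> seq A -> M)
    (f : M -> seq A -> N) (x : M) (s : seq A) : N :=
  let m := (size s).+1 in
  \sum_(1 <= k < m.+1)
     (-1) ^+ (m - k) *: f (opM x (take k.-1 s)) (drop k.-1 s) +
  \sum_(1 <= j < m) \sum_(1 <= k < (m - j).+1)
     (-1) ^+ (j * k + (m - j - k)) *: f x (insert_op j.-1 k s).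

(* [am_op x s] is m_i^M (x (x) s) with i = size s + 1, so that m_i^M, of      *)
(* degree 2 - i, has degree 1 - size s.                                       *)
Record ainfModule := AinfModule {
  am_mod :> gradedModule R;
  am_op : am_mod -> seq A -> am_mod;
  am_op_hom : forall n : nat, is_hom n (1 - n%:Z) am_op;
  am_op_rel : forall x s, precomp am_op am_op x s = 0
}.

Definition minimal (M : ainfModule) : Prop := forall x : M, am_op x [::] = 0.

(* As for [am_op], [f x s] is f_i (x (x) s) with i = size s + 1; its degree   *)
(* 1 - i is - size s.                                                         *)
Record is_morphism (M N : ainfModule) (f : M -> seq A -> N) : Prop := {
  morphism_hom : forall n : nat, is_hom n (- n%:Z) f;
  morphism_rel : forall x s, precomp (@am_op M) f x s =
    \sum_(1 <= r < (size s).+2) am_op (f x (take r.-1 s)) (drop r.-1 s)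
}.

(* f_1 induces a bijection from the cohomology of (M, m_1^M) to that of       *)
(* (N, m_1^N): the two fields are its injectivity and its surjectivity.       *)
Record quasi_iso (M N : ainfModule) (f : M -> seq A -> N) : Prop := {
  quasi_iso_inj : forall x : M, am_op x [::] = 0 ->
    (exists y : N, f x [::] = am_op y [::]) -> exists x' : M, x = am_op x' [::];
  quasi_iso_surj : forall y : N, am_op y [::] = 0 ->
    exists x : M, am_op x [::] = 0 /\
      exists y' : N, y = f x [::] + am_op y' [::]
}.

(* Graded right A-modules. *)
Record gradedAModule := GradedAModule {
  gam_mod :> gradedModule R;
  gact : gam_mod -> A -> gam_mod;
  gact_linearl : forall a, linear (gact^~ a);
  gact_linearr : forall x, linear (gact x);
  gactA : forall x a b, gact (gact x a) b = gact x (gmul a b);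
  gact_homog : forall d e x a,
    homog d x -> homog e a -> homog (d + e) (gact x a)
}.

Definition gam_op (N : gradedAModule) (x : N) (s : seq A) : N :=
  if s is [:: a] then gact x a else 0.

Section GradedAModuleAinf.

Variable N : gradedAModule.

Lemma gact0 (x : N) : gact x 0 = 0.
Proof.
have h := gact_linearr x 1 0 0; rewrite !scale1r addr0 in h.
by move/eqP: h; rewrite -subr_eq subrr eq_sym => /eqP.
Qed.

Lemma g0act (a : A) : gact (0 : N) a = 0.
Proof.
have /= h := gact_linearl (g := N) a 1 0 0; rewrite !scale1r addr0 in h.
by move/eqP: h; rewrite -subr_eq subrr eq_sym => /eqP.
Qed.

Lemma gam_op_hom (n : nat) : is_hom n (1 - n%:Z) (@gam_op N).
Proof.
split; first split.
- move=> s _ c u v; case: s => [|a [|b s]] /=; rewrite ?scaler0 ?addr0 //.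
  exact: (gact_linearl a c u v).
- move=> x [|b s] [|b' t] _ c u v; rewrite /= ?scaler0 ?addr0 //.
  + exact: (gact_linearr x c u v).
  + by case: s => [|b' s]; rewrite /= scaler0 addr0.
  + by case: s => [|b'' s]; rewrite /= scaler0 addr0.
- move=> d ds x [|a [|b s]] <- hx; try by move=> _; apply: homog0.
  case: ds => [|e [|e' ds]] //= [ha] // _.
  by rewrite big_seq1 subrr addr0; apply: gact_homog.
Qed.

Lemma gam_op_rel x s : precomp (@gam_op N) (@gam_op N) x s = 0.
Proof.
rewrite /precomp; set m := (size s).+1.
have [s2|sN2] := eqVneq (size s) 2%N.
  rewrite /m; case: s s2 {m} => [|a [|b [|]]] //= _.
  rewrite !unlock /= gactA !scaler0 !addr0 !add0r.
  rewrite (_ : 3 - 2 = 1)%N // (_ : 1 * 2 + (3 - 1 - 2) = 2)%N //.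
  by rewrite expr1 sqrrN expr1n scaleN1r scale1r addNr.
rewrite big1_seq ?add0r => [|k]; last first.
  rewrite mem_index_iota => /andP[_ /andP[k1 km]].
  case Ed: (drop k.-1 s) => [|b [|]] /=; rewrite ?scaler0 //.
  case Et: (take k.-1 s) => [|a [|]] /=; rewrite ?g0act ?scaler0 //.
  by move: sN2; rewrite -(cat_take_drop k.-1 s) Ed Et.
rewrite big1_seq // => j; rewrite mem_index_iota => /andP[_ /andP[j1 jm]].
rewrite big1_seq // => k; rewrite mem_index_iota => /andP[_ /andP[k1 km]].
rewrite /insert_op.
case Et: (take j.-1 s) => [|a t] /=; last by case: t {Et} => [|? ?]; rewrite scaler0.
case Ed: (drop (j.-1 + k) s) => [|b t] /=; last by rewrite scaler0.
case Ek: (take k (drop j.-1 s)) => [|a [|b [|]]] /=; rewrite ?gact0 ?scaler0 //.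
move: sN2; rewrite -(cat_take_drop j.-1 s) Et /= -(cat_take_drop k (drop j.-1 s)).
by rewrite drop_drop addnC Ed Ek.
Qed.

(* A graded module as an A-infinity module with m_i = 0 for i <> 2. *)
Definition ainf_of_gam : ainfModule := AinfModule gam_op_hom gam_op_rel.

End GradedAModuleAinf.

Section Mtwo.

Variables (M : ainfModule) (hM : minimal M).

Let act (x : M) (a : A) : M := am_op x [:: a].

Lemma m2_linearl a : linear (act^~ a).
Proof. by move: (am_op_hom M 1) => [[h _] _]; apply: h. Qed.

Lemma m2_linearr x : linear (act x).
Proof. by move: (am_op_hom M 1) => [[_ h] _]; apply: (h x [::] [::]). Qed.

Lemma m2A x a b : act (act x a) b = act x (gmul a b).
Proof.
have h0 t : am_op (0 : M) t = 0.
  have [[h _] _] := am_op_hom M (size t).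
  have := h t erefl 1 0 0; rewrite !scale1r addr0 /= => /eqP.
  by rewrite -subr_eq subrr eq_sym => /eqP.
have z t u : (size t + size u).+1 = 2%N -> am_op x (t ++ 0 :: u) = 0.
  move=> e; have [[_ h] _] := am_op_hom M 2.
  have := h x t u e 1 0 0; rewrite !scale1r addr0 /= => /eqP.
  by rewrite -subr_eq subrr eq_sym => /eqP.
have := am_op_rel x [:: a; b]; rewrite /precomp !unlock /=.
rewrite /insert_op /= !hM (h0 [:: a; b]).
rewrite (z [::] [:: b]) // (z [:: a] [::]) // !scaler0 !addr0 !add0r.
rewrite (_ : 3 - 2 = 1)%N // (_ : 1 * 2 + (3 - 1 - 2) = 2)%N //.
rewrite expr1 sqrrN expr1n scaleN1r scale1r => /eqP.
by rewrite addrC subr_eq0 => /eqP.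
Qed.

Lemma m2_homog d e x a : homog d x -> homog e a -> homog (d + e) (act x a).
Proof.
move=> hx ha; have [_ h] := am_op_hom M 1.
have := h d [:: e] x [:: a] erefl hx (conj ha I).
by rewrite big_seq1 subrr addr0.
Qed.

Definition m2_gam : gradedAModule :=
  GradedAModule m2_linearl m2_linearr m2A m2_homog.

(* M(2) *)
Definition M2 : ainfModule := ainf_of_gam m2_gam.

End Mtwo.

Definition formal (M : ainfModule) : Prop :=
  exists (hM : minimal M) (f : M2 hM -> seq A -> M),
    is_morphism f /\ quasi_iso f.

Section Hochschild.

Variable N : gradedAModule.

Implicit Type f : N -> seq A -> N.

(* C^{p,q}(A, N) *)
Definition cochain (p : nat) (q : int) f : Prop := is_hom p q f.

Definition cochain_eq (p : nat) f g : Prop :=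
  forall x s, size s = p -> f x s = g x s.

(* The differential C^{p,q} -> C^{p+1,q}. *)
Definition hoch_d (p : nat) f : N -> seq A -> N := fun x s =>
  \sum_(1 <= j < p.+1) (-1) ^+ (p - j) *: f x (insert_op j.-1 2 s)
  - gam_op (f x (take p s)) (drop p s)
  + (-1) ^+ p *: f (gam_op x (take 1 s)) (drop 1 s).

Definition cocycle p q f : Prop :=
  cochain p q f /\ cochain_eq p.+1 (hoch_d p f) (fun _ _ => 0).

Definition coboundary p q f : Prop :=
  if p is p'.+1 then
    exists g, cochain p' q g /\ cochain_eq p f (hoch_d p' g)
  else cochain_eq 0 f (fun _ _ => 0).

(* Torsion-freeness of HH^{p,q}(A, N) = cocycles / coboundaries: if r <> 0    *)
(* kills the class of f, then that class is 0.                                *)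
Definition HH_torsion_free (p : nat) (q : int) : Prop :=
  forall (r : R) f, r != 0 -> cocycle p q f ->
    coboundary p q (fun x s => r *: f x s) -> coboundary p q f.

End Hochschild.

End AInfinity.

Definition finitely_generated (R : comNzRingType) (V : lmodType R) : Prop :=
  exists (n : nat) (e : 'I_n -> V),
    forall v, exists c : 'I_n -> R, v = \sum_i c i *: e i.

Definition projective (R : comNzRingType) (V : lmodType R) : Prop :=
  forall (P Q : lmodType R) (g : {linear P -> Q}) (h : {linear V -> Q}),
    (forall y, exists x, g x = y) ->
    exists k : {linear V -> P}, forall v, g (k v) = h v.

Definition finite_projective (R : comNzRingType) (V : lmodType R) : Prop :=
  finitely_generated V /\ projective V.

Section BaseChange.

Variables (R K : comNzRingType) (phi : {rmorphism R -> K}).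

(* (V', iota) is K (x)_R V, with iota v = 1 (x) v, specified by the universal *)
(* property of extension of scalars. Then V'_d is automatically the K-span    *)
(* of the image of V_d, i.e. K (x)_R V_d.                                     *)
Record base_change (V : gradedModule R) (V' : gradedModule K)
    (iota : {linear V -> V' | phi \; *:%R}) : Prop := {
  base_change_lift : forall (W : lmodType K) (g : {linear V -> W | phi \; *:%R}),
    exists h : {linear V' -> W}, forall v, h (iota v) = g v;
  base_change_uniq : forall (W : lmodType K) (h h' : {linear V' -> W}),
    (forall v, h (iota v) = h' (iota v)) -> forall v', h v' = h' v';
  base_change_homog : forall d v, homog d v -> homog d (iota v)
}.

(* M' over A' is K (x)_R M over K (x)_R A: the operations of A' and M' are    *)
(* the K-multilinear extensions of those of A and M.                          *)
Definition ainf_base_change (A : gradedAlgebra R) (M : ainfModule A)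
    (A' : gradedAlgebra K) (M' : ainfModule A') : Prop :=
  exists (iA : {linear A -> A' | phi \; *:%R})
         (iM : {linear M -> M' | phi \; *:%R}),
    [/\ base_change iA, base_change iM,
        forall a b, iA (gmul a b) = gmul (iA a) (iA b)
      & forall x s, iM (am_op x s) = am_op (iM x) (map iA s)].

End BaseChange.

(* phi : R -> K exhibits K as the fraction field of R / P. *)
Definition is_residue_field (R : comNzRingType) (P : prime_idealr R)
    (K : fieldType) (phi : {rmorphism R -> K}) : Prop :=
  (forall r, (phi r == 0) = (r \in (P : {pred R}))) /\
  (forall c : K, exists a b : R, phi b != 0 /\ c = phi a / phi b).

(* Main.v *)
From HB Require Import structures.
Require Import Defs.
From Stdlib Require Import IndefiniteDescription.
From mathcomp Require Import all_boot all_order all_algebra zify.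

(** Since the algebra A is strictly associative, an A-infinity structure on M
    enters the equation of a morphism linearly, and the whole problem takes
    place in a convolution algebra. For families f, g of multilinear maps write

      (f * g)(x; s) = sum over s = s1 ++ s2 of f(g(x; s1); s2),

    D for the bar differential, which multiplies two adjacent entries of s, and
    e for the sign (-1)^(size s). Then D is a square-zero derivation twisted by
    e ([bar_dK], [bar_d_conv]), the A-infinity relation is D m + e m * m = 0,
    and f is a morphism from (M, m) to (N, n) exactly when its defect

      d f = D f + e f * m - n * f

    vanishes. Two identities follow formally: the Leibniz rule
    d (f * g) = d f * g + e f * d g ([defect_conv]), and a Bianchi identity for
    d f ([bar_d_defect]).

    A morphism f : M -> M(2) with f_1 = id is built one arity at a time
    ([exists_to_M2]). If d f vanishes on fewer than p arguments, the Bianchi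
    identity makes its component with p arguments a Hochschild cocycle of
    bidegree (p, 1 - p) ([defect_cocycle]). This cocycle is a torsion class: the
    formality of the generic fibre gives a morphism M_eta(2) -> M_eta which can
    be normalized to have linear part the identity ([formal_normalize]), and
    multiplying its finitely many components of small arity by a common
    denominator r gives a family G : M(2) -> M over R itself, of linear part r,
    with no defect in low arity ([generic_formal_approx]). By the Leibniz rule,
    r times the cocycle is then the Hochschild differential of a component of
    f * G. Torsion-freeness makes the cocycle itself a coboundary, and
    subtracting a primitive from f kills the obstruction ([partial_step]).

    The inverse g of f for the convolution product is a morphism M(2) -> M by
    the Leibniz rule again ([family_inverse], [inverse_defect]), so M is formal.
    As A and M are finite projective, multilinear families extend along any
    change of scalars R -> K through dual bases ([family_base_change]); the
    extension of g to a fibre still has linear part the identity and no defect,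
    because both can be checked on elements coming from R. Hence every fibre is
    formal ([formal_base_change]). *)

Set Implicit Arguments.
Unset Strict Implicit.
Unset Printing Implicit Defensive.

Import Order.TTheory GRing.Theory Num.Theory.
Local Open Scope ring_scope.

(** * The convolution algebra of families of multilinear maps *)

(** Maps are kept as bare functions with a linearity proof: the same family is
    linear in each of its variables, and no single bundled map covers them. *)
Section LinearFacts.
Variables (R : comNzRingType) (U V : lmodType R) (h : U -> V).
Hypothesis hL : linear h.

Lemma lin0 : h 0 = 0.
Proof.
have := hL 1 0 0; rewrite !scale1r addr0 => /eqP.
by rewrite -subr_eq subrr eq_sym => /eqP.
Qed.

Lemma linD u v : h (u + v) = h u + h v.
Proof. by rewrite -[u]scale1r hL !scale1r. Qed.

Lemma linZ a u : h (a *: u) = a *: h u.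
Proof. by rewrite -[a *: u]addr0 hL lin0 addr0. Qed.

Lemma linB u v : h (u - v) = h u - h v.
Proof. by rewrite -scaleN1r linD linZ scaleN1r. Qed.

Lemma lin_sum (I : Type) (r : seq I) (F : I -> U) :
  h (\sum_(i <- r) F i) = \sum_(i <- r) h (F i).
Proof. exact: (big_morph h linD lin0). Qed.

End LinearFacts.

Section Convolution.

Variables (R : comNzRingType) (A : gradedAlgebra R).

Definition alt (N : lmodType R) (phi : seq A -> N) (s : seq A) : N :=
  (-1) ^+ size s *: phi s.

(** The term of the bar differential that merges [a] with the first entry of
    the list behind it. *)
Definition face (N : lmodType R) (phi : seq A -> N) (a : A) (t : seq A) : N :=
  if t is b :: u then (-1) ^+ size u *: phi (gmul a b :: u) else 0.

(** Recursion on the list, instead of the alternating sum over merging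
    positions, makes the identities below one-step inductions. *)
Fixpoint bar_d (N : lmodType R) (phi : seq A -> N) (s : seq A) : N :=
  if s is a :: t then face phi a t + bar_d (fun u => phi (a :: u)) t else 0.

(** The convolution product, with the module variable of the inner family
    already applied; recursion on the list sums over all its splittings. *)
Fixpoint conv (M N : lmodType R) (f : M -> seq A -> N) (phi : seq A -> M)
    (s : seq A) : N :=
  if s is a :: t then f (phi [::]) s + conv f (fun u => phi (a :: u)) t
  else f (phi [::]) [::].

Definition mlin (N : lmodType R) (phi : seq A -> N) :=
  forall s t, linear (fun a => phi (s ++ a :: t)).

Section BarD.
Variables (M : lmodType R).
Implicit Types (phi psi : seq A -> M).

Lemma eq_bar_d phi psi s :
  (forall t, (size t).+1 = size s -> phi t = psi t) -> bar_d phi s = bar_d psi s.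
Proof.
elim: s phi psi => [|a t IH] phi psi //= e; congr (_ + _).
  by case: t e {IH} => [|b u] //= e; rewrite e.
by apply: IH => u su; apply: e => /=; rewrite su.
Qed.

Lemma bar_dD (c : R) phi psi s :
  bar_d (fun t => c *: phi t + psi t) s = c *: bar_d phi s + bar_d psi s.
Proof.
elim: s phi psi => [|a t IH] phi psi /=; first by rewrite scaler0 addr0.
rewrite IH scalerDr addrACA; congr (_ + _).
case: t {IH} => [|b u] /=; first by rewrite scaler0 addr0.
by rewrite scalerDr !scalerA mulrC.
Qed.

Lemma bar_dZ (c : R) phi s : bar_d (fun t => c *: phi t) s = c *: bar_d phi s.
Proof.
rewrite (eq_bar_d (psi := fun t => c *: phi t + c *: 0)) => [|t _].
  rewrite (bar_dD c phi (fun=> c *: 0)).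
  suff -> : bar_d (fun=> c *: 0 : M) s = 0 by rewrite addr0.
  elim: s => [|a t IH] //=; rewrite IH addr0 scaler0.
  by case: t {IH} => [|b u] /=; rewrite ?scaler0.
by rewrite scaler0 addr0.
Qed.

Lemma bar_d0 s : bar_d (fun=> 0 : M) s = 0.
Proof.
rewrite -[RHS](scale0r (bar_d (fun=> 0 : M) s)) -bar_dZ.
by apply: eq_bar_d => t _; rewrite scaler0.
Qed.

Lemma bar_dN phi s : bar_d (fun t => - phi t) s = - bar_d phi s.
Proof.
by rewrite -scaleN1r -bar_dZ; apply: eq_bar_d => t _; rewrite scaleN1r.
Qed.

Lemma bar_dDr phi psi s :
  bar_d (fun t => phi t + psi t) s = bar_d phi s + bar_d psi s.
Proof.
rewrite -[X in _ = X + _]scale1r -bar_dD.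
by apply: eq_bar_d => t _; rewrite scale1r.
Qed.

Lemma bar_dB phi psi s :
  bar_d (fun t => phi t - psi t) s = bar_d phi s - bar_d psi s.
Proof. by rewrite (bar_dDr phi (fun t => - psi t)) bar_dN. Qed.

(** D changes the arity by one, so it anticommutes with the sign. *)
Lemma bar_d_alt phi s : bar_d (alt phi) s = - alt (bar_d phi) s.
Proof.
rewrite /alt; case: s => [|a t]; first by rewrite /= scaler0 oppr0.
rewrite (eq_bar_d (psi := fun u => (-1) ^+ size t *: phi u)) => [|u /= [->]//].
by rewrite bar_dZ /= exprS mulN1r scaleNr opprK.
Qed.

End BarD.

Section Conv.
Variables (L M N : lmodType R).
Implicit Types (f g : M -> seq A -> N) (phi psi : seq A -> M).

Lemma eq_conv f g phi psi s :
  (forall x t, (size t <= size s)%N -> f x t = g x t) ->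
  (forall t, (size t <= size s)%N -> phi t = psi t) ->
  conv f phi s = conv g psi s.
Proof.
elim: s phi psi => [|a t IH] phi psi /= ef ep; first by rewrite ep // ef.
rewrite ep // ef //; congr (_ + _); apply: IH => [x u su|u su].
  by rewrite ef // ltnW.
by rewrite ep.
Qed.

Lemma convDl f g phi s :
  conv (fun x t => f x t + g x t) phi s = conv f phi s + conv g phi s.
Proof. by elim: s phi => [|a t IH] phi //=; rewrite IH addrACA. Qed.

Lemma convZl c f phi s :
  conv (fun x t => c *: f x t) phi s = c *: conv f phi s.
Proof. by elim: s phi => [|a t IH] phi //=; rewrite IH scalerDr. Qed.

Lemma convNl f phi s :
  conv (fun x t => - f x t) phi s = - conv f phi s.
Proof. by elim: s phi => [|a t IH] phi //=; rewrite IH opprD. Qed.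

(** Only the splitting that passes the whole list to [f] can contribute. *)
Lemma conv_left f phi s :
  (forall x t, (size t < size s)%N -> f x t = 0) ->
  conv f phi s = f (phi [::]) s.
Proof.
case: s => [|a t] //= e; rewrite -[RHS]addr0; congr (_ + _).
have {}e x u : (size u <= size t)%N -> f x u = 0 by move=> ?; apply: e.
elim: t (fun u => phi _) e => [|b u IH] psi e /=; first exact: e.
by rewrite e // add0r IH // => x v sv; apply: e; rewrite /= ltnW.
Qed.

Section Additivity.
Variable f : M -> seq A -> N.
Hypothesis fL : forall s, linear (f^~ s).

Lemma conv_linear c phi psi s :
  conv f (fun t => c *: phi t + psi t) s = c *: conv f phi s + conv f psi s.
Proof.
by elim: s phi psi => [|a t IH] phi psi /=; rewrite fL // IH scalerDr addrACA.
Qed.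

(** Only the splitting that passes the whole list to [phi] can contribute. *)
Lemma conv_right phi s :
  (forall t, (size t < size s)%N -> phi t = 0) ->
  conv f phi s = f (phi s) [::].
Proof.
elim: s phi => [|a t IH] phi //= e.
rewrite e // (lin0 (fL _)) add0r IH // => u su.
exact: e.
Qed.

Lemma convDr phi psi s :
  conv f (fun t => phi t + psi t) s = conv f phi s + conv f psi s.
Proof.
rewrite -[X in _ = X + _]scale1r -conv_linear.
by apply: eq_conv => // t _; rewrite scale1r.
Qed.

Lemma convZr c phi s : conv f (fun t => c *: phi t) s = c *: conv f phi s.
Proof.
by elim: s phi => [|a t IH] phi /=; rewrite (linZ (fL _)) // IH scalerDr.
Qed.

Lemma convNr phi s : conv f (fun t => - phi t) s = - conv f phi s.
Proof.
rewrite -scaleN1r -convZr.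
by apply: eq_conv => // t _; rewrite scaleN1r.
Qed.

End Additivity.

Lemma alt_linear f : (forall s, linear (f^~ s)) ->
  forall s, linear ((fun x => alt (f x))^~ s).
Proof. by move=> fL s c u v; rewrite /alt fL // scalerDr !scalerA mulrC. Qed.

Section AltConv.
Variable f : M -> seq A -> N.
Hypothesis fL : forall s, linear (f^~ s).
Let aL := alt_linear fL.

Lemma conv_alt phi s :
  conv (fun x => alt (f x)) (alt phi) s = alt (conv f phi) s.
Proof.
rewrite /alt; elim: s phi => [|a t IH] phi /=.
  by rewrite !expr0 !scale1r.
rewrite expr0 scale1r scalerDr; congr (_ + _).
rewrite [in RHS]exprS mulN1r scaleNr -IH -(convNr aL).
by apply: eq_conv => // u _; rewrite exprS mulN1r scaleNr.
Qed.

Lemma convA (g : L -> seq A -> M) (phi : seq A -> L) s :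
  conv f (conv g phi) s = conv (fun x => conv f (g x)) phi s.
Proof.
elim: s phi => [|a t IH] phi //=.
rewrite (convDr fL (fun u => g (phi [::]) (a :: u))) addrA; congr (_ + _).
exact: (IH (fun u => phi (a :: u))).
Qed.

(** A merge never straddles the cut of a splitting, so it happens inside [f] or
    inside [phi]; in the second case the entries left to [f] give its sign. *)
Lemma bar_d_conv phi s :
  bar_d (conv f phi) s =
  conv (fun x => bar_d (f x)) phi s + conv (fun x => alt (f x)) (bar_d phi) s.
Proof.
elim: s phi => [|a t IH] phi /=.
  by rewrite /alt (lin0 (fL _)) scaler0 addr0.
rewrite (bar_dDr (fun u => f (phi [::]) (a :: u))) IH.
rewrite {2}/alt (lin0 (fL _)) scaler0 add0r.
rewrite (convDr aL (face phi a)).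
suff -> : face (conv f phi) a t = face (f (phi [::])) a t +
    conv (fun x => alt (f x)) (face phi a) t.
  move: (bar_d _ t) (conv _ _ t) (conv _ _ t) (conv _ _ t) => u1 u2 u3 u4.
  by rewrite addrACA (addrCA u4) !addrA.
case: t {IH} => [|b u]; rewrite /= {1}/alt (lin0 (fL _)) scaler0.
  by rewrite addr0.
rewrite add0r scalerDr; congr (_ + _).
by rewrite (conv_alt (fun v => phi (gmul a b :: v))).
Qed.

End AltConv.

End Conv.

(** Merges at distant positions cancel in pairs by sign, and the two ways of
    merging three consecutive entries cancel by associativity. *)
Lemma bar_dK (N : lmodType R) (phi : seq A -> N) s : bar_d (bar_d phi) s = 0.
Proof.
elim: s phi => [|a t IH] phi //=.
rewrite (bar_dDr (face phi a)) IH addr0.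
case: t {IH} => [|b [|c u]]; rewrite /= ?addr0 ?scaler0 ?addr0 //.
set chi := fun v => phi (gmul a b :: v).
have -> : face (fun v => (-1) ^+ size v *: chi v) c u +
    bar_d (fun v => (-1) ^+ size (c :: v) *: chi (c :: v)) u
    = (-1) ^+ size u *: bar_d chi (c :: u).
  transitivity (bar_d (alt chi) (c :: u)) => //.
  by rewrite bar_d_alt /alt /= exprS mulN1r scaleNr opprK.
by rewrite exprS mulN1r scaleNr -gmulA /= -scalerDr addNr.
Qed.

End Convolution.

(** * The defect of a family from being a morphism *)

Section Defect.
Variables (R : comNzRingType) (A : gradedAlgebra R).

Section Def.
Variables (P Q : lmodType R) (muP : P -> seq A -> P) (muQ : Q -> seq A -> Q).
Implicit Types (f : P -> seq A -> Q).

Definition defect f (x : P) (s : seq A) : Q :=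
  bar_d (f x) s + conv (fun y => alt (f y)) (muP x) s - conv muQ (f x) s.

(** The defect on a list involves components of arity at most its size. *)
Lemma eq_defect f g x s :
  (forall y t, (size t <= size s)%N -> f y t = g y t) ->
  defect f x s = defect g x s.
Proof.
move=> e; rewrite /defect; congr (_ + _ - _).
- by apply: eq_bar_d => t st; apply: e; rewrite -st.
- by apply: eq_conv => // y t st; rewrite /alt e.
- by apply: eq_conv => // t st; rewrite e.
Qed.

Lemma defect_linear (muQL : forall s, linear (muQ^~ s)) c f g x s :
  defect (fun y t => c *: f y t + g y t) x s =
  c *: defect f x s + defect g x s.
Proof.
rewrite /defect bar_dD conv_linear //.
have -> : conv (fun y => alt (fun t => c *: f y t + g y t)) (muP x) s =
    c *: conv (fun y => alt (f y)) (muP x) s + conv (fun y => alt (g y)) (muP x) s.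
  rewrite -convZl -convDl; apply: eq_conv => // y t _.
  by rewrite /alt scalerDr !scalerA mulrC.
by rewrite scalerBr scalerDr opprD [X in X + _]addrACA [LHS]addrACA.
Qed.

End Def.

Definition op_relation (P : lmodType R) (mu : P -> seq A -> P) :=
  forall x s, bar_d (mu x) s + conv (fun y => alt (mu y)) (mu x) s = 0.

Lemma altK (N : lmodType R) (phi : seq A -> N) s : alt (alt phi) s = phi s.
Proof. by rewrite /alt scalerA -expr2 sqrr_sign scale1r. Qed.

Section Identities.
Variables (P Q S : lmodType R) (muP : P -> seq A -> P) (muQ : Q -> seq A -> Q)
  (muS : S -> seq A -> S).

(** The Leibniz rule: the terms in which [muQ] acts between [f] and [g] occur
    in both summands with opposite signs. *)
Lemma defect_conv (f : Q -> seq A -> S) (g : P -> seq A -> Q)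
  (fL : forall s, linear (f^~ s)) (muSL : forall s, linear (muS^~ s)) x s :
  defect muP muS (fun y => conv f (g y)) x s =
  conv (defect muQ muS f) (g x) s +
  conv (fun y => alt (f y)) (defect muP muQ g x) s.
Proof.
have aL := alt_linear fL.
have E1 : conv (defect muQ muS f) (g x) s =
    conv (fun y => bar_d (f y)) (g x) s +
    conv (fun y => alt (f y)) (conv muQ (g x)) s - conv muS (conv f (g x)) s.
  by rewrite (convA aL) // (convA muSL) // -convDl -convNl -convDl.
have E2 : conv (fun y => alt (f y)) (defect muP muQ g x) s =
    conv (fun y => alt (f y)) (bar_d (g x)) s +
    conv (fun y => alt (f y)) (conv (fun y => alt (g y)) (muP x)) s -
    conv (fun y => alt (f y)) (conv muQ (g x)) s.
  by rewrite -(convDr aL) -(convNr aL) -(convDr aL).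
rewrite E1 E2 /defect (bar_d_conv fL).
have -> : conv (fun y => alt (conv f (g y))) (muP x) s =
    conv (fun y => alt (f y)) (conv (fun y => alt (g y)) (muP x)) s.
  rewrite (convA aL); apply: eq_conv => // y t _.
  by rewrite -(conv_alt fL).
by rewrite [RHS](AC (3*3) ((1*4*5*3)*(2*6))) /= subrr addr0.
Qed.

(** The Bianchi identity. Expanding the definition of the defect, the terms
    without two operations cancel by [bar_dK] and [bar_d_conv], and those with
    two operations by the A-infinity relations of [muP] and [muQ]. *)
Lemma bar_d_defect (f : P -> seq A -> Q)
  (fL : forall s, linear (f^~ s)) (muQL : forall s, linear (muQ^~ s))
  (relP : op_relation muP) (relQ : op_relation muQ) x s :
  bar_d (defect muP muQ f x) s +
  conv (fun y => alt (defect muP muQ f y)) (muP x) s +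
  conv (fun y => alt (muQ y)) (defect muP muQ f x) s = 0.
Proof.
have aL := alt_linear fL; have aQL := alt_linear muQL.
rewrite (bar_dB (fun t => bar_d (f x) t + _)) (bar_dDr (bar_d (f x))) bar_dK.
rewrite add0r (bar_d_conv aL) (bar_d_conv muQL).
have -> : conv (fun y => bar_d (alt (f y))) (muP x) s =
    - conv (fun y => alt (bar_d (f y))) (muP x) s.
  by rewrite -convNl; apply: eq_conv => // y t _; rewrite bar_d_alt.
have -> : conv (fun y => alt (alt (f y))) (bar_d (muP x)) s =
    - conv f (conv (fun y => alt (muP y)) (muP x)) s.
  rewrite -(convNr fL); apply: eq_conv => [y t _|t _]; first exact: altK.
  by apply/eqP; rewrite -subr_eq0 opprK relP.
have -> : conv (fun y => bar_d (muQ y)) (f x) s =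
    - conv (fun y => alt (muQ y)) (conv muQ (f x)) s.
  rewrite (convA aQL) -convNl; apply: eq_conv => // y t _.
  by apply/eqP; rewrite -subr_eq0 opprK relQ.
have -> : conv (fun y => alt (defect muP muQ f y)) (muP x) s =
    conv (fun y => alt (bar_d (f y))) (muP x) s +
    conv f (conv (fun y => alt (muP y)) (muP x)) s -
    conv (fun y => alt (muQ y)) (conv (fun y => alt (f y)) (muP x)) s.
  rewrite (convA fL) (convA aQL) -convDl -convNl -convDl.
  apply: eq_conv => // y t _; rewrite {1}/alt /defect scalerBr scalerDr.
  congr (_ + _ - _).
    rewrite -/(alt (conv _ _) t) -(conv_alt aL).
    by apply: eq_conv => // z u _; rewrite altK.
  by rewrite -/(alt (conv _ _) t) -(conv_alt muQL).
have -> : conv (fun y => alt (muQ y)) (defect muP muQ f x) s =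
    conv (fun y => alt (muQ y)) (bar_d (f x)) s +
    conv (fun y => alt (muQ y)) (conv (fun y => alt (f y)) (muP x)) s -
    conv (fun y => alt (muQ y)) (conv muQ (f x)) s.
  by rewrite -(convDr aQL) -(convNr aQL) -(convDr aQL).
rewrite opprD opprK [LHS](AC (((2*2)*3)*3)
  (((1*5)*(2*6))*((3*10)*(4*8))*(7*9))) /=.
by rewrite !addNr subrr !addr0.
Qed.

End Identities.
End Defect.

Section Bridge.
Variables (R : comNzRingType) (A : gradedAlgebra R).

Lemma conv_sum (M N : lmodType R) (f : M -> seq A -> N) (phi : seq A -> M) s :
  conv f phi s =
  \sum_(1 <= k < (size s).+2) f (phi (take k.-1 s)) (drop k.-1 s).
Proof.
rewrite big_add1 /=; elim: s phi => [|a t IH] phi /=.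
  by rewrite big_nat1.
by rewrite IH [RHS]big_nat_recl //=.
Qed.

Lemma bar_d_sum (N : lmodType R) (phi : seq A -> N) s :
  bar_d phi s =
  \sum_(1 <= j < size s) (-1) ^+ (size s - j.+1) *: phi (insert_op j.-1 2 s).
Proof.
elim: s phi => [|a t IH] phi /=; first by rewrite big_geq.
rewrite IH; case: t {IH} => [|b u] /=; first by rewrite !big_geq // addr0.
rewrite [RHS]big_nat_recl // subn2 /= /insert_op /= drop0; congr (_ + _).
  by rewrite take0.
by apply: eq_big_nat => [[|i]] //= _; rewrite subSS.
Qed.

Lemma mlin0 (N : lmodType R) (phi : seq A -> N) s t :
  mlin phi -> phi (s ++ 0 :: t) = 0.
Proof. by move=> h; apply: (lin0 (h s t)). Qed.

(** The operations of A vanish except in arity two, so among the inserted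
    operations only the merges survive, with the sign of [bar_d]. *)
Lemma precompE (M N : lmodType R) (op : M -> seq A -> M) (f : M -> seq A -> N)
    x s : mlin (f x) ->
  precomp op f x s = conv (fun y => alt (f y)) (op x) s + bar_d (f x) s.
Proof.
move=> fL; rewrite /precomp; congr (_ + _).
  rewrite conv_sum; apply: eq_big_nat => k /andP[k1 km].
  by case: k k1 km => [|k] //= _ _; rewrite /alt size_drop subSS.
have z j k : (0 < j)%N -> (0 < k)%N -> (j + k <= (size s).+1)%N -> k != 2%N ->
    f x (insert_op j.-1 k s) = 0.
  move=> j0 k0 jk k2; rewrite /insert_op.
  have : size (take k (drop j.-1 s)) = k by rewrite size_takel // size_drop; lia.
  case: (take k _) => [|a [|b [|c u]]] /= sk; rewrite ?(mlin0 _ _ fL) //.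
  by rewrite -sk in k2.
rewrite bar_d_sum; case: (posnP (size s)) => [->|s0]; first by rewrite !big_geq.
rewrite big_nat_recr //= subSnn [X in _ + X]big_nat1 z // ?addn1 //.
rewrite scaler0 addr0; apply: eq_big_nat => j /andP[j1 js].
rewrite (bigD1_seq 2%N) ?iota_uniq //= ?mem_index_iota; last by lia.
rewrite big1_seq ?addr0 => [|k /andP[k2]]; last first.
  rewrite mem_index_iota => /andP[k1 km].
  by rewrite z ?scaler0 //; lia.
rewrite exprD mulnC exprM sqrrN !expr1n mul1r.
by congr (_ ^+ _ *: _); lia.
Qed.

Section Action.
Variable N : gradedAModule A.

Lemma conv_act_left (phi : seq A -> N) n s : size s = n.+1 ->
  conv (@gam_op _ _ N) phi s = gam_op (phi (take n s)) (drop n s).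
Proof.
elim: s n phi => [|a t IH] n phi //= [<-].
case: t IH => [|b u] IH; first by rewrite /= addr0.
by rewrite (IH (size u)) // [gam_op _ _]/= add0r.
Qed.

Lemma conv_head (M P : lmodType R) (f : M -> seq A -> P) (phi : seq A -> M) s :
  (forall s, linear (f^~ s)) -> (forall a t, phi (a :: t) = 0) ->
  conv f phi s = f (phi [::]) s.
Proof.
move=> fL; case: s => [|a t] //= z; rewrite -[RHS]addr0; congr (_ + _).
set psi := fun u => phi (a :: u).
have {z}: forall u, psi u = 0 by move=> u; apply: z.
elim: t psi => [|b u IH] psi z /=; rewrite z (lin0 (fL _)) //.
by rewrite add0r IH.
Qed.

(** The Hochschild differential is the defect between graded modules, because
    [gam_op] lives on a single algebra argument and thereby selects the two
    extreme splittings of the list. *)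
Lemma hoch_dE (n : nat) (f : N -> seq A -> N) x s :
  (forall s, linear (f^~ s)) -> size s = n.+1 ->
  hoch_d n f x s = defect (@gam_op _ _ N) (@gam_op _ _ N) f x s.
Proof.
move=> fL sn; rewrite /hoch_d /defect addrAC; congr (_ + _ - _).
- by rewrite bar_d_sum sn; apply: eq_big_nat => j _; rewrite subSS.
- case: s sn => [|a t] //= [tn].
  rewrite /alt {1}(lin0 (fL _)) scaler0 add0r take0 drop0.
  by rewrite (conv_head _ (alt_linear fL)) //= -tn.
- by rewrite (conv_act_left _ sn).
Qed.

End Action.
End Bridge.

(** * Graded modules, multilinearity and degrees *)

Section Homog.
Variables (R : comNzRingType) (V : gradedModule R).

Lemma homogD d (u v : V) : homog d u -> homog d v -> homog d (u + v).
Proof. by move=> hu hv; have := homogP 1 hu hv; rewrite scale1r. Qed.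

Lemma homogZ d c (u : V) : homog d u -> homog d (c *: u).
Proof. by move=> hu; rewrite -[_ *: _]addr0; apply/homogP/homog0. Qed.

Lemma homogB d (u v : V) : homog d u -> homog d v -> homog d (u - v).
Proof. by move=> hu hv; rewrite -scaleN1r; apply/homogD/homogZ. Qed.

Lemma homog_sum d (I : eqType) (r : seq I) (F : I -> V) :
  (forall i, i \in r -> homog d (F i)) -> homog d (\sum_(i <- r) F i).
Proof.
move=> h; rewrite big_seq; elim/big_rec: _ => [|i x ir hx].
  exact: homog0.
exact/homogD/hx/h.
Qed.

End Homog.

Section GradedSums.
Variables (R : comNzRingType) (V : gradedModule R).

(** The support may be enlarged at will, which lets several elements be
    decomposed over one common set of degrees. *)
Lemma homog_decomposition (v : V) : exists (D : seq int) (w : int -> V),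
  (forall d, homog d (w d)) /\
  forall D', uniq D' -> {subset D <= D'} -> v = \sum_(d <- D') w d.
Proof.
have [D [w [uD wh vE]]] := homog_span v.
exists D, (fun d => if d \in D then w d else 0); split=> [d|D' uD' sDD'].
  by case: ifP => _ //; apply: homog0.
rewrite -big_mkcond /= -big_filter vE; apply: perm_big.
apply: uniq_perm => //; first exact: filter_uniq.
move=> d; rewrite mem_filter; case: (boolP (d \in D)) => //= dD.
by rewrite sDD'.
Qed.

Lemma homog_component (D : seq int) (w : int -> V) d :
  uniq D -> d \in D -> (forall e, homog e (w e)) ->
  homog d (\sum_(e <- D) w e) ->
  \sum_(e <- D) w e = w d /\ forall e, e \in D -> e != d -> w e = 0.
Proof.
move=> uD dD wh; set v := \sum_(e <- D) w e => vh.
have z e : e \in D -> w e - (if e == d then v else 0) = 0.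
  apply: (homog_indep (w := fun e => w e - (if e == d then v else 0))) => //.
    move=> e'; apply: homogB => //.
    by case: eqP => [->//|_]; apply: homog0.
  rewrite sumrB -/v (bigD1_seq d) //= eqxx.
  by rewrite big1 ?addr0 ?subrr // => i /negPf ->.
split=> [|e eD ed]; last by have := z e eD; rewrite (negPf ed) subr0.
by have /eqP := z d dD; rewrite eqxx subr_eq0 => /eqP.
Qed.

End GradedSums.

(** The components of [v] in degrees other than [d] are sent to components of
    [h v] in those degrees, which vanish. *)
Lemma homog_descent (R K : comNzRingType) (V : gradedModule R)
    (W : gradedModule K) (h : V -> W) :
  (forall u v, h (u + v) = h u + h v) -> (forall v, h v = 0 -> v = 0) ->
  (forall d v, homog d v -> homog d (h v)) ->
  forall d v, homog d (h v) -> homog d v.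
Proof.
move=> hD hI hH d v hv.
have h0 : h 0 = 0 by apply: (addrI (h 0)); rewrite -hD !addr0.
have [D [w [wh wE]]] := homog_decomposition v.
have dS : d \in undup (d :: D) by rewrite mem_undup inE eqxx.
have vE : v = \sum_(e <- undup (d :: D)) w e.
  by apply: wE => [|e eD]; rewrite ?undup_uniq // mem_undup inE eD orbT.
have [|_ z] := homog_component (undup_uniq _) dS (fun e => hH _ _ (wh e)).
  by rewrite -(big_morph h hD h0) -vE.
rewrite vE (bigD1_seq d) ?undup_uniq //= big1_seq ?addr0 // => e /andP[ed eS].
by apply: hI; apply: z.
Qed.

Section Families.
Variables (R : comNzRingType) (A : gradedAlgebra R).

(** Each algebra argument lowers the degree by one, as in the grading of
    A-infinity operations ([q = 1]) and morphisms ([q = 0]). *)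
Definition degr (N : gradedModule R) (q : int) (phi : seq A -> N) :=
  forall ds s, homog_seq ds s ->
    homog (q + \sum_(e <- ds) e - (size s)%:Z) (phi s).

(** A family whose components of every arity are homogeneous multilinear maps;
    all arities at once, since convolution mixes them. *)
Record hom_family (M N : gradedModule R) (q : int) (f : M -> seq A -> N) : Prop := {
  hom_lin : forall s, linear (f^~ s);
  hom_mlin : forall x, mlin (f x);
  hom_degr : forall d x, homog d x -> degr (q + d) (f x) }.

Lemma hom_familyP (M N : gradedModule R) q (f : M -> seq A -> N) :
  hom_family q f <-> (forall n : nat, is_hom n (q - n%:Z) f).
Proof.
split=> [[fL fM fD] n|h].
  split; first by split=> [s _|x s t _]; [apply: fL | apply: fM].
  move=> d ds x s <- hx hs.
  by rewrite (_ : _ + _ = q + d + \sum_(e <- ds) e - (size s)%:Z);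
    [apply: fD | lia].
split.
- by move=> s; have [[+ _] _] := h (size s); apply.
- by move=> x s t; have [[_ +] _] := h (size s + size t).+1; apply.
- move=> d x hx ds s hs; have [_ +] := h (size s).
  move=> /(_ d ds x s erefl hx hs).
  by rewrite (_ : _ + _ = q + d + \sum_(e <- ds) e - (size s)%:Z) //; lia.
Qed.

Lemma sum_cons (e : int) ds :
  \sum_(i <- e :: ds) i = e + \sum_(i <- ds) i :> int.
Proof. exact: big_cons. Qed.

Section MlinDegr.
Variable N : gradedModule R.
Implicit Types (phi psi : seq A -> N).

Lemma mlin_cons phi a : mlin phi -> mlin (fun u => phi (a :: u)).
Proof. by move=> h s t; apply: (h (a :: s) t). Qed.

Lemma mlinD c phi psi : mlin phi -> mlin psi -> mlin (fun s => c *: phi s + psi s).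
Proof.
move=> h1 h2 s t b u v; rewrite h1 h2 !scalerDr !scalerA mulrC.
by rewrite addrACA.
Qed.

Lemma mlin_alt phi : mlin phi -> mlin (alt phi).
Proof.
move=> h s t b u v; rewrite /alt h scalerDr !scalerA mulrC.
by rewrite !size_cat.
Qed.

Lemma mlin_bar_d phi : mlin phi -> mlin (bar_d phi).
Proof.
move=> h s t; elim: s phi h => [|b s IH] phi h c u v /=.
  rewrite (eq_bar_d (psi := fun w => c *: phi (u :: w) + phi (v :: w))); last first.
    by move=> w _; apply: (h [::] w).
  rewrite bar_dD scalerDr addrACA; congr (_ + _).
  case: t => [|b t] /=; first by rewrite scaler0 addr0.
  rewrite gmul_linearl (h [::]) /= scalerDr !scalerA mulrC.
  by [].
rewrite IH; last exact: mlin_cons.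
rewrite scalerDr addrACA; congr (_ + _).
case: s {IH} => [|b' s] /=.
  by rewrite gmul_linearr (h [::]) /= scalerDr !scalerA mulrC.
rewrite (h (gmul b b' :: s)) !size_cat /= scalerDr !scalerA mulrC.
by [].
Qed.

Lemma degr_cons q phi e a :
  degr q phi -> homog e a -> degr (q + e - 1) (fun u => phi (a :: u)).
Proof.
move=> h ha ds s hs; have := h (e :: ds) (a :: s) (conj ha hs).
by rewrite sum_cons /=; congr homog; lia.
Qed.

Lemma degr_bar_d q phi : degr q phi -> degr (q + 1) (bar_d phi).
Proof.
move=> h ds s; elim: s ds q phi h => [|a t IH] [|e ds] q phi h //=.
  by move=> _; apply: homog0.
move=> [ha ht]; apply: homogD; last first.
  have := IH ds _ _ (degr_cons h ha) ht.
  rewrite sum_cons; congr homog; lia.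
case: t ds ht {IH} => [|b u] [|e' ds] //=; first by move=> _; apply: homog0.
move=> [hb hu]; apply: homogZ.
have := h ((e + e') :: ds) (gmul a b :: u) (conj (gmul_homog ha hb) hu).
by rewrite !sum_cons /=; congr homog; lia.
Qed.

Lemma degrD q c phi psi :
  degr q phi -> degr q psi -> degr q (fun s => c *: phi s + psi s).
Proof. by move=> h1 h2 ds s hs; apply: homogP; [apply: h1 | apply: h2]. Qed.

Lemma degr_alt q phi : degr q phi -> degr q (alt phi).
Proof. by move=> h ds s hs; apply/homogZ/h. Qed.

End MlinDegr.

Lemma mlin_conv (M N : gradedModule R) (f : M -> seq A -> N) phi :
  (forall s, linear (f^~ s)) -> (forall x, mlin (f x)) -> mlin phi ->
  mlin (conv f phi).
Proof.
move=> fL fM h s t; elim: s phi h => [|b s IH] phi h c u v /=.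
  rewrite (fM _ [::]) /= scalerDr addrACA; congr (_ + _).
  rewrite -conv_linear //; apply: eq_conv => // w _.
  exact: (h [::] w).
rewrite (IH (fun u => phi (b :: u))); last exact: mlin_cons.
by rewrite (fM _ (b :: s)) scalerDr addrACA.
Qed.

Lemma degr_conv (M N : gradedModule R) p q (f : M -> seq A -> N) phi :
  hom_family p f -> degr q phi -> degr (p + q) (conv f phi).
Proof.
move=> hf h ds s; elim: s ds q phi h => [|a t IH] [|e ds] q phi h //.
  move=> _; apply: (hom_degr hf _ (ds := [::])) => //.
  by have := h [::] [::] I; rewrite big_nil addr0 subr0.
move=> [ha ht] /=; apply: homogD.
  have h0 : homog q (phi [::]).
    by have := h [::] [::] I; rewrite big_nil addr0 subr0.
  exact: (hom_degr hf h0 (conj ha ht : homog_seq (e :: ds) (a :: t))).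
have := IH ds _ _ (degr_cons h ha) ht.
by rewrite sum_cons; congr homog; lia.
Qed.

Section HomFamily.
Variables M N P : gradedModule R.

Lemma hom_family_comb q c (f g : M -> seq A -> N) : hom_family q f -> hom_family q g ->
  hom_family q (fun x s => c *: f x s + g x s).
Proof.
move=> [fL fM fD] [gL gM gD]; split=> [s b u v|x|d x hx].
- by rewrite fL gL !scalerDr !scalerA mulrC addrACA.
- exact: mlinD.
- by apply: degrD; [apply: fD | apply: gD].
Qed.

Lemma hom_alt q (f : M -> seq A -> N) :
  hom_family q f -> hom_family q (fun x => alt (f x)).
Proof.
move=> [fL fM fD]; split=> [|x|d x hx]; first exact: alt_linear.
  exact: mlin_alt.
exact/degr_alt/fD.
Qed.

Lemma hom_bar_d q (f : M -> seq A -> N) :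
  hom_family q f -> hom_family (q + 1) (fun x => bar_d (f x)).
Proof.
move=> [fL fM fD]; split=> [s c u v|x|d x hx].
- by rewrite -bar_dD; apply: eq_bar_d => t _; apply: fL.
- exact: mlin_bar_d.
- by rewrite addrAC; apply/degr_bar_d/fD.
Qed.

Lemma hom_conv p q (f : N -> seq A -> P) (g : M -> seq A -> N) :
  hom_family p f -> hom_family q g -> hom_family (p + q) (fun x => conv f (g x)).
Proof.
move=> hf hg; have fL := hom_lin hf; split=> [s c u v|x|d x hx].
- by rewrite -conv_linear //; apply: eq_conv => // t _; apply: (hom_lin hg).
- by apply: mlin_conv => //; [apply: (hom_mlin hf) | apply: (hom_mlin hg)].
- by rewrite -addrA; apply: (degr_conv hf); apply: (hom_degr hg).
Qed.

Lemma eq_hom_family q (f g : M -> seq A -> N) :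
  (forall x s, f x s = g x s) -> hom_family q f -> hom_family q g.
Proof.
move=> e [fL fM fD]; split=> [s c u v|x s t c u v|d x hx ds s hs].
- by rewrite -!e fL.
- by rewrite -!e fM.
- by rewrite -e; apply: fD.
Qed.

End HomFamily.

Lemma hom_defect (M N : gradedModule R) (muM : M -> seq A -> M)
   (muN : N -> seq A -> N) (f : M -> seq A -> N) :
  hom_family 1 muM -> hom_family 1 muN -> hom_family 0 f ->
  hom_family 1 (defect muM muN f).
Proof.
move=> hM hN hf.
have h1 := hom_bar_d hf; rewrite add0r in h1.
have h2 := hom_conv (hom_alt hf) hM; rewrite add0r in h2.
have h3 := hom_conv hN hf; rewrite addr0 in h3.
apply: eq_hom_family (hom_family_comb (-1) h3 (hom_family_comb 1 h1 h2)) => x s.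
by rewrite /defect scaleN1r scale1r addrC.
Qed.

Definition trunc (P : pred nat) (M N : lmodType R) (f : M -> seq A -> N) :=
  fun x s => if P (size s) then f x s else 0.

Lemma hom_trunc (P : pred nat) (M N : gradedModule R) q (f : M -> seq A -> N) :
  (forall n, P n -> is_hom n (q - n%:Z) f) -> hom_family q (trunc P f).
Proof.
move=> h; apply/hom_familyP => n; case: (boolP (P n)) => Pn; last first.
  rewrite /trunc; split; first split.
  - by move=> s -> c u v; rewrite (negPf Pn) scaler0 addr0.
  - move=> x s t e c u v; rewrite !size_cat /= !addnS e (negPf Pn).
    by rewrite scaler0 addr0.
  - by move=> d ds x s -> _ _; rewrite (negPf Pn); apply: homog0.
have [[hL hM] hD] := h n Pn; rewrite /trunc; split; first split.
- by move=> s sn c u v; rewrite sn Pn hL.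
- by move=> x s t e c u v; rewrite !size_cat /= !addnS e Pn hM.
- by move=> d ds x s sn; rewrite sn Pn; apply: hD.
Qed.

End Families.

(** * Obstruction theory for morphisms to the underlying graded module *)

Section AinfFacts.
Variables (R : comNzRingType) (A : gradedAlgebra R).

Lemma am_op_hom_family (M : ainfModule A) : hom_family 1 (@am_op R A M).
Proof. exact/hom_familyP/am_op_hom. Qed.

Lemma am_op_relation (M : ainfModule A) : op_relation (@am_op R A M).
Proof.
move=> x s; rewrite addrC -precompE ?am_op_rel //.
exact: (hom_mlin (am_op_hom_family M)).
Qed.

Lemma is_morphismP (M N : ainfModule A) (f : M -> seq A -> N) :
  is_morphism f <->
  hom_family 0 f /\ forall x s, defect (@am_op R A M) (@am_op R A N) f x s = 0.
Proof.
split=> [[fh fr]|[fh fr]].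
  have hf : hom_family 0 f by apply/hom_familyP => n; rewrite sub0r.
  split=> // x s; rewrite /defect [X in X - _]addrC -precompE; last exact: (hom_mlin hf).
  by rewrite fr conv_sum subrr.
split=> [n|x s]; first by have /hom_familyP/(_ n) := fh; rewrite sub0r.
rewrite -conv_sum precompE; last exact: (hom_mlin fh).
by apply/eqP; rewrite -subr_eq0 [X in X - _]addrC; apply/eqP/fr.
Qed.

(** An outer family without components of arity at most [n] leaves fewer than
    [size s - n] entries to the inner one. *)
Lemma conv_cut (M N : lmodType R) (f : M -> seq A -> N) (phi psi : seq A -> M) n s :
  (forall y t, (size t <= n)%N -> f y t = 0) ->
  (forall t, (size t + n < size s)%N -> phi t = psi t) ->
  conv f phi s = conv f psi s.
Proof.
move=> fn; elim: s phi psi => [|a t IH] phi psi e /=; first by rewrite !fn.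
congr (_ + _); last by apply: IH => u su; apply: e.
have [tn|tn] := leqP (size (a :: t)) n; first by rewrite !fn.
by rewrite e.
Qed.

(** A sequence of families that becomes stationary in each arity converges:
    the limit takes its component of arity [n] from the [n]-th family. *)
Lemma family_limit (M N : gradedModule R) q (F : nat -> M -> seq A -> N) :
  (forall n, hom_family q (F n)) ->
  (forall n x s, (size s <= n)%N -> F n.+1 x s = F n x s) ->
  exists f, hom_family q f /\
    forall n x s, (size s <= n)%N -> f x s = F n x s.
Proof.
move=> Fh FS; pose f x s := F (size s) x s.
have fF n x s : (size s <= n)%N -> f x s = F n x s.
  elim: n => [|n IH]; first by rewrite leqn0 /f => /eqP ->.
  by rewrite leq_eqVlt => /predU1P[<- //|sn]; rewrite FS // IH.
exists f; split=> //; split=> [s c u v|x s t c u v|d x hx ds s hs].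
- by rewrite /f (hom_lin (Fh _)).
- rewrite !(fF (size s + size t).+1) ?size_cat ?addnS //.
  exact: (hom_mlin (Fh _)).
- by rewrite /f; apply: (hom_degr (Fh _)).
Qed.

(** The unit of the convolution product. *)
Definition id_family (M : lmodType R) (x : M) (s : seq A) : M :=
  if s is [::] then x else 0.

Lemma id_family_hom (M : gradedModule R) : hom_family 0 (@id_family M).
Proof.
split=> [s c u v|x s t c u v|d x hx ds s].
- by case: s => [|a s] /=; rewrite ?scaler0 ?addr0.
- by case: s => [|a s] /=; rewrite ?scaler0 ?addr0.
- case: s ds => [|a s] [|e ds] //= _; last exact: homog0.
  by rewrite big_nil add0r addr0 subr0.
Qed.

End AinfFacts.

Section Obstruction.
Variables (R : comNzRingType) (A : gradedAlgebra R).
Variables (M : ainfModule A) (hM : minimal M).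

Let m : M -> seq A -> M := @am_op R A M.
Let m2 : M -> seq A -> M := @gam_op R A (m2_gam hM).

Let mH : hom_family 1 m := am_op_hom_family M.
Let m2H : hom_family 1 m2 := am_op_hom_family (M2 hM).
Let m_rel : op_relation m := @am_op_relation R A M.
Let m2_rel : op_relation m2 := @am_op_relation R A (M2 hM).
Let mL := hom_lin mH.
Let m2L := hom_lin m2H.

Lemma m_m2 x t : (size t <= 1)%N -> m x t = m2 x t.
Proof. by case: t => [|a [|b t]] //= _; apply: hM. Qed.

Lemma alt_m2 y t : alt (m2 y) t = - m2 y t.
Proof.
rewrite /alt; case: t => [|a [|b t]]; rewrite /= ?scaler0 ?oppr0 //.
by rewrite expr1 scaleN1r.
Qed.

(** Minimality of both structures improves [eq_defect] by one arity. *)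
Lemma defect_strict (T : M -> seq A -> M) x s : (forall s, linear (T^~ s)) ->
  (forall y t, (size t < size s)%N -> T y t = 0) -> defect m m2 T x s = 0.
Proof.
move=> TL T0; rewrite /defect.
rewrite (eq_bar_d (psi := fun=> 0)) ?bar_d0; last first.
  by move=> t st; apply: T0; rewrite -st.
rewrite conv_left; last by move=> y t st; rewrite /alt T0 ?scaler0.
rewrite /m hM /alt (lin0 (TL _)) scaler0 conv_right //; last first.
  by move=> t st; apply: T0.
by rewrite addr0 subr0.
Qed.

Definition partial_morphism n (f : M -> seq A -> M) := 
  [/\ hom_family 0 f, forall x, f x [::] = x
    & forall x s, (size s <= n)%N -> defect m m2 f x s = 0].

Lemma id_partial : partial_morphism 1 (@id_family R A M).
Proof.
split=> //; first exact: id_family_hom.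
move=> x [|a [|b s]] //= _.
  by rewrite /defect /= /alt /= /m hM scaler0 !add0r oppr0.
rewrite /defect /= /alt /= /m expr0 scale1r scaler0 !add0r addr0.
exact: subrr.
Qed.

(** Correcting a family in arity [n] first changes its defect in arity [n + 1],
    and there only through the binary operation of [M], which is that of
    [M(2)]. *)
Lemma hoch_d_defect n (g : M -> seq A -> M) x s :
  is_hom n (- n%:Z) g -> size s = n.+1 ->
  hoch_d (N := m2_gam hM) n g x s = defect m m2 (trunc (pred1 n) g) x s.
Proof.
move=> hg sn; set T := trunc _ _.
have TH : hom_family 0 T by apply: hom_trunc => k /= /eqP ->; rewrite sub0r.
have -> : hoch_d (N := m2_gam hM) n g x s = hoch_d (N := m2_gam hM) n T x s.
  rewrite /hoch_d; congr (_ - gam_op _ _ + _ *: _).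
  - apply: eq_big_nat => j /andP[j1 jn].
    rewrite /T /trunc /insert_op size_cat /= size_takel; last by lia.
    by rewrite size_drop ifT //=; lia.
  - by rewrite /T /trunc size_takel ?sn //= eqxx.
  - by rewrite /T /trunc size_drop sn /= subn1 eqxx.
rewrite hoch_dE //; last exact: (hom_lin TH).
rewrite /defect; congr (_ + _ - _).
case: n hg sn @T TH => [|n] hg sn T TH.
  by apply: eq_conv => // t st; apply/esym/m_m2; rewrite -sn.
apply: (@conv_cut _ _ _ _ _ _ _ n) => [y t tn|t st].
  by rewrite /alt /T /trunc /= ltn_eqF ?scaler0.
by apply/esym/m_m2; lia.
Qed.

(** This is the Bianchi identity in the first arity where it says something:
    on [n + 2] arguments, a defect that starts in arity [n + 1] meets only the
    binary part of [m]. *)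
Lemma defect_cocycle n f : partial_morphism n f ->
  cocycle (N := m2_gam hM) n.+1 (1 - n.+1%:Z) (defect m m2 f).
Proof.
move=> [fH f1 f0]; have phiH := hom_defect mH m2H fH.
split; first by have /hom_familyP := phiH; apply.
move=> x s sn; rewrite hoch_dE //; last exact: (hom_lin phiH).
have <- := bar_d_defect (hom_lin fH) m2L m_rel m2_rel x s.
rewrite {1}/defect; congr (_ + _ + _).
  apply: (@conv_cut _ _ _ _ _ _ _ n) => [y t tn|t st].
    by rewrite /alt f0 ?scaler0.
  by apply/esym/m_m2; lia.
rewrite -convNl; apply: eq_conv => // y t _.
by rewrite -/(alt (m2 y) t) alt_m2.
Qed.

(** [G] witnesses that the obstruction is torsion: by the Leibniz rule the
    defect of [conv f G] in arity [n + 1] is [r] times the defect of [f], and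
    it is also a Hochschild coboundary, as [conv f G] is a family from [M(2)] to
    itself. *)
Lemma partial_step (tfHH : forall n : nat, HH_torsion_free (m2_gam hM) n (1 - n%:Z))
  (approx : forall n : nat, exists (r : R) (G : M -> seq A -> M),
    [/\ r != 0, hom_family 0 G, forall x, G x [::] = r *: x
      & forall x s, (size s <= n)%N -> defect m2 m G x s = 0])
  n f : (0 < n)%N -> partial_morphism n f ->
  exists f', partial_morphism n.+1 f' /\
    forall x s, (size s < n)%N -> f' x s = f x s.
Proof.
move=> n0 pf; have [fH f1 f0] := pf.
have phiH := hom_defect mH m2H fH.
have [r [G [r0 GH G1 G0]]] := approx n.+1.
have en : 1 - n.+1%:Z = - n%:Z by lia.
have : coboundary (N := m2_gam hM) n.+1 (1 - n.+1%:Z) (defect m m2 f).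
  apply: (tfHH n.+1) r0 (defect_cocycle pf) _.
  have fGH := hom_conv fH GH; rewrite add0r in fGH.
  exists (fun x => conv f (G x)); split.
    by rewrite en; have /hom_familyP/(_ n) := fGH; rewrite sub0r.
  move=> x s sn; rewrite hoch_dE //; last exact: (hom_lin fGH).
  rewrite (@defect_conv _ _ _ _ _ m2 m m2) //; last exact: (hom_lin fH).
  rewrite conv_left; last by move=> y t ts; apply: f0; rewrite sn in ts.
  rewrite G1 (linZ (hom_lin phiH _)).
  rewrite conv_right; first last.
  - by move=> t ts; apply: G0; rewrite -sn ltnW.
  - exact/alt_linear/(hom_lin fH).
  by rewrite G0 ?sn // /alt (lin0 (hom_lin fH _)) scaler0 addr0.
move=> [g [gh eg]]; rewrite en in gh.
set T := trunc (pred1 n) g.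
have TH : hom_family 0 T by apply: hom_trunc => k /= /eqP ->; rewrite sub0r.
exists (fun x s => -1 *: T x s + f x s); split; first split.
- exact: hom_family_comb.
- by move=> x; rewrite f1 /T /trunc /= eq_sym gtn_eqF // scaler0 add0r.
- move=> x s sn; rewrite defect_linear // scaleN1r addrC.
  have [s_n|s_n] := leqP (size s) n.
    rewrite f0 // defect_strict ?subr0 //; first exact: (hom_lin TH).
    move=> y t ts; rewrite /T /trunc /= ltn_eqF //.
    exact: leq_trans ts s_n.
  have {}sn : size s = n.+1 by apply/eqP; rewrite eqn_leq sn.
  by rewrite -hoch_d_defect // -eg // subrr.
- by move=> x s sn; rewrite /T /trunc /= ltn_eqF // scaler0 add0r.
Qed.

(** The corrections of successive steps happen in increasing arities, so they
    converge; choice is needed to make all of them at once. *)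
Lemma exists_to_M2
  (tfHH : forall n : nat, HH_torsion_free (m2_gam hM) n (1 - n%:Z))
  (approx : forall n : nat, exists (r : R) (G : M -> seq A -> M),
    [/\ r != 0, hom_family 0 G, forall x, G x [::] = r *: x
      & forall x s, (size s <= n)%N -> defect m2 m G x s = 0]) :
  exists f : M -> seq A -> M,
    [/\ hom_family 0 f, forall x, f x [::] = x
      & forall x s, defect m m2 f x s = 0].
Proof.
have step n (f : {f | partial_morphism n.+1 f}) :
    {f' : {f | partial_morphism n.+2 f} |
       forall x s, (size s <= n)%N -> sval f' x s = sval f x s}.
  have [f' [pf' ef']] := constructive_indefinite_description _
    (partial_step tfHH approx (ltn0Sn n) (svalP f)).
  by exists (exist _ f' pf').
pose F := nat_rect (fun n => {f | partial_morphism n.+1 f})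
  (exist _ _ id_partial) (fun n f => sval (step n f)).
have [||f [fH fF]] := @family_limit R A M M 0 (fun n => sval (F n)).
- by move=> n; have [] := svalP (F n).
- by move=> n x s sn; apply: (svalP (step n (F n))).
exists f; split=> // x.
  by rewrite (fF 0) //; have [_ ->] := svalP (F 0).
move=> s; rewrite (eq_defect _ _ (g := sval (F (size s)))); last exact: fF.
by have [_ _ ->] := svalP (F (size s)).
Qed.

End Obstruction.

(** * Inverting families and normalizing their linear part *)

Section Inverse.
Variables (R : comNzRingType) (A : gradedAlgebra R).

Section ConvId.
Variables M N : lmodType R.

Lemma conv_concentrated (f : M -> seq A -> N) (phi : seq A -> M) s :
  (forall y t, (0 < size t)%N -> f y t = 0) -> conv f phi s = f (phi s) [::].
Proof.
by move=> f0; elim: s phi => [|a t IH] phi //=; rewrite f0 // add0r IH.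
Qed.

Lemma conv_id_family (f : M -> seq A -> N) x s : (forall s, linear (f^~ s)) ->
  conv f (@id_family R A M x) s = f x s.
Proof. by move=> fL; rewrite conv_head. Qed.

Lemma bar_d_id_family x s : bar_d (@id_family R A M x) s = 0.
Proof.
case: s => [|a s] //=; rewrite (@bar_d0 R A M) addr0.
by case: s => [|b s] //=; rewrite scaler0.
Qed.

End ConvId.

(** Solves [g = id + (g - f * g)] by iteration: as [f] is the identity in
    arity 0, the component of [g - f * g] on [n] arguments involves only
    components of [g] with fewer arguments. *)
Lemma family_inverse (M : gradedModule R) (f : M -> seq A -> M) :
  hom_family 0 f -> (forall x, f x [::] = x) ->
  exists g : M -> seq A -> M, [/\ hom_family 0 g, forall x, g x [::] = x
    & forall x s, conv f (g x) s = id_family x s].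
Proof.
move=> fH f1; have fL := hom_lin fH.
pose T (g : M -> seq A -> M) x s := id_family x s + (g x s - conv f (g x) s).
have TH g : hom_family 0 g -> hom_family 0 (T g).
  move=> gH; have fgH := hom_conv fH gH; rewrite addr0 in fgH.
  apply: eq_hom_family
    (hom_family_comb 1 (id_family_hom A M) (hom_family_comb (-1) fgH gH)).
  by move=> x s; rewrite /T scale1r scaleN1r [- _ + _]addrC.
have T_local g g' n : (forall x s, (size s <= n)%N -> g x s = g' x s) ->
    forall x s, (size s <= n.+1)%N -> T g x s = T g' x s.
  move=> e x s sn; rewrite /T; congr (_ + _).
  have -> : conv f (g x) s = conv f (g' x) s + (g x s - g' x s).
    rewrite -[g x s - g' x s]f1.
    rewrite -(conv_right fL (phi := fun t => g x t - g' x t)); last first.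
      by move=> t st; rewrite e ?subrr // -ltnS (leq_trans st).
    rewrite -(convDr fL); apply: eq_conv => // t _.
    by rewrite addrC subrK.
  by rewrite opprD opprB (AC (1*(1*2)) ((1*4)*(3*2))) /= subrr add0r.
(* [F n] is the truncated geometric series of [id - f]. *)
pose F n := iter n T (@id_family R A M).
have [||g [gH gF]] := @family_limit R A M M 0 F.
- by elim=> [|n IH]; [apply: id_family_hom | apply: TH].
- elim=> [|n IH] x s sn; last exact: T_local IH _ _ sn.
  case: s sn => // _; rewrite /F /= /T /=.
  by rewrite f1 subrr addr0.
exists g; split=> // [x|x s]; first by rewrite (gF 0).
have e : g x s = T g x s.
  rewrite (gF (size s).+1) //; apply: (T_local _ _ (size s)) => //.
  by move=> y t ts; rewrite (gF (size s)).
apply/eqP; rewrite eq_sym -subr_eq0; apply/eqP.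
by apply: (addrI (g x s)); rewrite addr0 {2}e /T addrCA.
Qed.

(** The identity has no defect, so the Leibniz rule leaves [alt f] convolved
    with the defect of [g] equal to zero. As the linear part of [f] is
    injective, the defect of [g] vanishes by induction on the arity. *)
Lemma inverse_defect (M N : gradedModule R) (muM : M -> seq A -> M)
    (muN : N -> seq A -> N) (f : M -> seq A -> N) (g : N -> seq A -> M) :
  (forall s, linear (f^~ s)) -> (forall s, linear (muN^~ s)) ->
  (forall x, f x [::] = 0 -> x = 0) ->
  (forall x s, conv f (g x) s = id_family x s) ->
  (forall x s, defect muM muN f x s = 0) ->
  forall x s, defect muN muM g x s = 0.
Proof.
move=> fL muL f1 fg f0 x s.
have aL := alt_linear fL.
have z u : conv (fun y => alt (f y)) (defect muN muM g x) u = 0.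
  have := defect_conv muN muM (muS := muN) g fL muL x u.
  rewrite (eq_conv (g := fun _ _ => 0) (psi := g x)) //.
  rewrite conv_concentrated // add0r => <-.
  rewrite (eq_defect _ _ (g := @id_family R A N)) // /defect.
  rewrite bar_d_id_family add0r conv_id_family // conv_concentrated.
    by rewrite /alt /= expr0 scale1r subrr.
  by move=> y [|a t] // _; rewrite /alt /= scaler0.
have [n] := ubnP (size s); elim: n s => // n IH s sn.
have := z s; rewrite conv_right //; last first.
  by move=> t ts; apply: IH; apply: leq_trans ts _.
by rewrite /alt expr0 scale1r; apply: f1.
Qed.

End Inverse.

Section Normalize.
Variables (R : comNzRingType) (A : gradedAlgebra R).

Lemma conv_precomp (L M N : lmodType R) (h : L -> M) (f : M -> seq A -> N) phi s :
  conv (fun y => f (h y)) phi s = conv f (fun t => h (phi t)) s.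
Proof. by elim: s phi => [|a t IH] phi //=; rewrite IH. Qed.

(** A quasi-isomorphism between minimal modules has a bijective linear part,
    which by the equation of morphisms in arity 1 commutes with the action of
    A; its inverse is thus a strict automorphism of [M(2)] to compose with. *)
Lemma formal_normalize (M : ainfModule A) : formal M ->
  exists (hM : minimal M) (g : M -> seq A -> M),
    [/\ hom_family 0 g, forall x, g x [::] = x
      & forall x s, defect (@am_op R A (M2 hM)) (@am_op R A M) g x s = 0].
Proof.
move=> [hM [g [/is_morphismP[gH g0] [gi gs]]]]; exists hM.
have gL := hom_lin gH.
have inj x : g x [::] = 0 -> x = 0.
  move=> gx; case: (gi x) => //.
  by exists 0; rewrite gx hM.
have surj y : exists x, g x [::] = y.
  have [x [_ [y' ->]]] := gs y (hM y).
  by exists x; rewrite hM addr0.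
pose th y := sval (constructive_indefinite_description _ (surj y)).
have gth y : g (th y) [::] = y by rewrite /th; case: constructive_indefinite_description.
have gI x y : g x [::] = g y [::] -> x = y.
  move=> e; apply/eqP; rewrite -subr_eq0; apply/eqP/inj.
  by rewrite (linB (gL _)) e subrr.
have thL : linear th.
  by move=> c u v; apply: gI; rewrite gL !gth.
have thm y t : th (@am_op R A (M2 hM) y t) = @am_op R A (M2 hM) (th y) t.
  case: t => [|a [|b t]]; try exact: (lin0 thL).
  apply: gI; rewrite gth.
  have := g0 (th y) [:: a]; rewrite /defect /= /alt /=.
  rewrite (lin0 (gL _)) scaler0 !add0r expr0 scale1r hM addr0 gth => /eqP.
  by rewrite subr_eq0 => /eqP.
exists (fun y => g (th y)); split.
- split=> [s c u v|x|d x hx].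
  + by rewrite thL gL.
  + exact: (hom_mlin gH).
  + apply: (hom_degr gH).
    apply: (@homog_descent R R M M (fun v => g v [::])) => //.
    * exact: (linD (gL _)).
    * move=> e v hv; have := hom_degr gH hv (ds := [::]) (s := [::]) I.
      by rewrite big_nil add0r addr0 subr0.
    * by rewrite gth.
- exact: gth.
- move=> y s; rewrite -(g0 (th y) s) /defect; congr (_ + _ - _).
  rewrite (conv_precomp th (fun y => alt (g y))); exact: eq_conv.
Qed.

End Normalize.

(** * Extension of scalars along finite projective modules *)

Lemma fraction_quotient (R : idomainType) (c : {fraction R}) :
  exists a b : R, (tofrac b != 0) /\ c = tofrac a / tofrac b.
Proof.
elim/quotW: c => x; exists (frac x).1, (frac x).2.
have d0 : tofrac (frac x).2 != 0 by rewrite tofrac_eq0 denom_ratioP.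
split=> //; apply: (mulIf d0); rewrite divfK //.
unlock FracField.tofrac; rewrite -[LHS]FracField.pi_mul; apply/eqmodP => /=.
rewrite FracField.equivfE /FracField.mulf !numden_Ratio ?oner_eq0 ?mulr1 ?denom_ratioP //.
by rewrite mulrC.
Qed.

Section DualBasis.
Variables (R : comNzRingType) (V : lmodType R).

Definition lincomb n (e : 'I_n -> V) (u : 'rV[R]_n) : V := \sum_i u 0 i *: e i.

Lemma lincomb_is_linear n (e : 'I_n -> V) : linear (lincomb e).
Proof.
move=> c u v; rewrite /lincomb scaler_sumr -big_split /=.
by apply: eq_bigr => i _; rewrite !mxE scalerDl scalerA.
Qed.

HB.instance Definition _ n (e : 'I_n -> V) :=
  GRing.isLinear.Build R 'rV[R]_n V *:%R (lincomb e) (lincomb_is_linear e).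

Lemma dual_basis : finite_projective V ->
  exists n (e : 'I_n -> V) (k : {linear V -> 'rV[R]_n}),
    forall v, v = lincomb e (k v).
Proof.
move=> [[n [e eV]] prV].
have surj y : exists x, (lincomb e : {linear _ -> _}) x = y.
  have [c ->] := eV y; exists (\row_i c i).
  by apply: eq_bigr => i _; rewrite mxE.
have [k kV] := prV _ _ (lincomb e : {linear _ -> _}) (idfun : {linear V -> V}) surj.
by exists n, e, k => v; rewrite kV.
Qed.

End DualBasis.

Section Coords.
Variables (R K : comNzRingType) (phi : {rmorphism R -> K}).
Variables (V : gradedModule R) (V' : gradedModule K).
Variable iota : {linear V -> V' | phi \; *:%R}.

Section MapCoord.
Variables (n : nat) (k : {linear V -> 'rV[R]_n}).

Definition map_coord (v : V) : 'rV[K]_n := map_mx phi (k v).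

Lemma map_coord_is_linear : linear_for (phi \; *:%R) map_coord.
Proof. by move=> c u v; rewrite /map_coord linearP map_mxD map_mxZ. Qed.

HB.instance Definition _ :=
  GRing.isLinear.Build R V 'rV[K]_n (phi \; *:%R) map_coord map_coord_is_linear.
End MapCoord.

(** A dual basis of a finite projective module extends to any of its base
    changes: the coordinate functions by existence in the universal property,
    the expansion of elements by uniqueness. *)
Lemma base_change_coords : base_change iota -> finite_projective V ->
  exists n (e : 'I_n -> V) (c : 'I_n -> V -> R) (c' : 'I_n -> V' -> K),
  [/\ forall i a u v, c' i (a *: u + v) = a * c' i u + c' i v,
      forall i v, c' i (iota v) = phi (c i v),
      forall v, v = \sum_i c i v *: e i
    & forall v', v' = \sum_i c' i v' *: iota (e i)].
Proof.
move=> bc /dual_basis[n [e [k ke]]].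
have [h hk] := base_change_lift bc (map_coord k : {linear _ -> _ | phi \; *:%R}).
exists n, e, (fun i v => k v 0 i), (fun i v' => h v' 0 i); split.
- by move=> i a u v; rewrite linearP !mxE.
- by move=> i v; rewrite hk /= /map_coord mxE.
- by move=> v; apply: ke.
move=> v'.
apply: (base_change_uniq bc (h := idfun)
  (h' := (lincomb (fun i => iota (e i)) \o h : {linear V' -> V'}))) => v /=.
rewrite hk [in LHS](ke v) /lincomb raddf_sum; apply: eq_bigr => i _.
by rewrite [LHS]linearZ /= /map_coord mxE.
Qed.

End Coords.

Section HomogBaseChange.
Variables (R K : comNzRingType) (phi : {rmorphism R -> K}).
Variables (V : gradedModule R) (V' : gradedModule K).
Variable iota : {linear V -> V' | phi \; *:%R}.

(** Expanding a generating set into homogeneous components over a common set of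
    degrees writes [v'] as a sum of homogeneous elements of the required shape,
    of which only the one of degree [d] remains. *)
Lemma base_change_homog_span d (v' : V') :
  base_change iota -> finite_projective V -> homog d v' ->
  exists L : seq (K * V), (forall p, p \in L -> homog d p.2) /\
    v' = \sum_(p <- L) p.1 *: iota p.2.
Proof.
move=> bc fpV hv.
have [n [e [_ [c' [_ _ _ v'E]]]]] := base_change_coords bc fpV.
have [D Dw] := fin_all_exists (fun i => homog_decomposition (e i)).
have {Dw}[w Dw] := fin_all_exists Dw.
(* One set of degrees for all generators; [d] is added in case none of them
   has a component there. *)
pose S := undup (d :: flatten [seq D i | i <- enum 'I_n]).
pose W f := \sum_i c' i v' *: iota (w i f).
have Wh f : homog f (W f).
  by apply: homog_sum => i _; apply/homogZ/(base_change_homog bc)/(Dw i).1.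
have v'W : v' = \sum_(f <- S) W f.
  rewrite exchange_big {1}[v']v'E; apply: eq_bigr => i _.
  rewrite -scaler_sumr -raddf_sum; congr (_ *: iota _).
  apply: (Dw i).2; first exact: undup_uniq.
  move=> f fD; rewrite mem_undup inE; apply/orP; right.
  by apply/flatten_mapP; exists i; rewrite ?mem_enum.
have dS : d \in S by rewrite mem_undup inE eqxx.
have [] := homog_component (undup_uniq _ : uniq S) dS Wh; first by rewrite -v'W.
rewrite -v'W => v'd _.
exists [seq (c' i v', w i d) | i <- enum 'I_n]; split.
  by move=> p /mapP[i _ ->]; apply: (Dw i).1.
by rewrite big_map big_enum.
Qed.

End HomogBaseChange.

Section Compat.
Variables (R K : comNzRingType) (phi : {rmorphism R -> K}).
Variables (A : gradedAlgebra R) (A' : gradedAlgebra K).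
Variable iA : {linear A -> A' | phi \; *:%R}.
Hypothesis iAM : forall a b, iA (gmul a b) = gmul (iA a) (iA b).

Section BarCompat.
Variables (N : lmodType R) (N' : lmodType K) (j : {linear N -> N' | phi \; *:%R}).

Lemma compat_sign n v : j ((-1) ^+ n *: v) = (-1) ^+ n *: j v.
Proof. by rewrite linearZ /= rmorph_sign. Qed.

Lemma bar_d_compat (f : seq A -> N) f' s :
  (forall s, j (f s) = f' (map iA s)) -> j (bar_d f s) = bar_d f' (map iA s).
Proof.
elim: s f f' => [|a t IH] f f' e /=; first exact: raddf0.
rewrite raddfD; congr (_ + _); last first.
  by apply: (IH (fun u => f (a :: u)) (fun u => f' (iA a :: u))) => s; apply: e.
case: t {IH} => [|b u] /=; first exact: raddf0.
by rewrite compat_sign e /= iAM size_map.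
Qed.

Lemma alt_compat (f : seq A -> N) f' s :
  (forall s, j (f s) = f' (map iA s)) -> j (alt f s) = alt f' (map iA s).
Proof. by move=> e; rewrite /alt compat_sign e size_map. Qed.

End BarCompat.

Section ConvCompat.
Variables (M N : lmodType R) (M' N' : lmodType K).
Variables (jM : {linear M -> M' | phi \; *:%R}) (jN : {linear N -> N' | phi \; *:%R}).

Lemma conv_compat (f : M -> seq A -> N) f' (psi : seq A -> M) psi' s :
  (forall x s, jN (f x s) = f' (jM x) (map iA s)) ->
  (forall s, jM (psi s) = psi' (map iA s)) ->
  jN (conv f psi s) = conv f' psi' (map iA s).
Proof.
move=> ef; elim: s psi psi' => [|a t IH] psi psi' ep /=.
  by rewrite ef ep.
rewrite raddfD /= ef ep; congr (_ + _).
by apply: (IH _ (fun u => psi' (iA a :: u))) => s; apply: ep.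
Qed.

End ConvCompat.

Section DefectCompat.
Variables (M N : lmodType R) (M' N' : lmodType K).
Variables (jM : {linear M -> M' | phi \; *:%R}) (jN : {linear N -> N' | phi \; *:%R}).

Lemma defect_compat muM muM' muN muN' (f : M -> seq A -> N) f' :
  (forall x s, jM (muM x s) = muM' (jM x) (map iA s)) ->
  (forall x s, jN (muN x s) = muN' (jN x) (map iA s)) ->
  (forall x s, jN (f x s) = f' (jM x) (map iA s)) ->
  forall x s, jN (defect muM muN f x s) = defect muM' muN' f' (jM x) (map iA s).
Proof.
move=> eM eN ef x s; rewrite /defect raddfB raddfD; congr (_ + _ - _) => /=.
- exact: bar_d_compat.
- apply: (conv_compat (f' := fun y => alt (f' y))) => [y t|t]; last exact: eM.
  exact: alt_compat.
- by apply: conv_compat => // t; apply: ef.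
Qed.
End DefectCompat.
End Compat.

Section Extension.
Variables (R K : comNzRingType) (phi : {rmorphism R -> K}).
Variables (A : gradedAlgebra R) (A' : gradedAlgebra K).
Variable iA : {linear A -> A' | phi \; *:%R}.
Hypotheses (bcA : base_change iA) (fpA : finite_projective A).

(** A multilinear map on the base change is determined on elements of A. *)
Lemma mlin_zero (N : gradedModule K) (psi : seq A' -> N) : mlin psi ->
  (forall s, psi (map iA s) = 0) -> forall s, psi s = 0.
Proof.
move=> pM pz s; elim: s psi pM pz => [|a t IH] psi pM pz; first exact: (pz [::]).
have [n [e [_ [c' [_ _ _ E]]]]] := base_change_coords bcA fpA.
rewrite [a]E (lin_sum (pM [::] t)) big1 // => i _.
rewrite (linZ (pM [::] t)) /= (IH (fun u => psi (iA (e i) :: u))) ?scaler0 //.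
  exact: mlin_cons.
by move=> s; apply: (pz (e i :: s)).
Qed.

Section Ext.
Variables (N : gradedModule R) (N' : gradedModule K).
Variable iN : {linear N -> N' | phi \; *:%R}.
Variables (n : nat) (e : 'I_n -> A) (c : 'I_n -> A -> R) (c' : 'I_n -> A' -> K).
Hypotheses (c'L : forall i a u v, c' i (a *: u + v) = a * c' i u + c' i v)
  (c'E : forall i v, c' i (iA v) = phi (c i v))
  (cE : forall v, v = \sum_i c i v *: e i).

(** The multilinear extension, computed on the generators [e] through the
    coordinates [c']; on elements of A it returns the values of [psi]
    ([extend_map]), so it depends on neither. *)
Fixpoint extend_scalars (psi : seq A -> N) (s : seq A') : N' :=
  if s is a :: t then \sum_i c' i a *: extend_scalars (fun u => psi (e i :: u)) t
  else iN (psi [::]).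

Lemma eq_extend psi psi' s : (forall t, psi t = psi' t) ->
  extend_scalars psi s = extend_scalars psi' s.
Proof.
elim: s psi psi' => [|a t IH] psi psi' E /=; first by rewrite E.
by apply: eq_bigr => i _; congr (_ *: _); apply: IH.
Qed.

Lemma extend_lincomb (I : Type) (r : seq I) (b : I -> R) (F : I -> seq A -> N) s :
  extend_scalars (fun u => \sum_(i <- r) b i *: F i u) s =
  \sum_(i <- r) phi (b i) *: extend_scalars (F i) s.
Proof.
elim: s F => [|a t IH] F /=.
  by rewrite raddf_sum; apply: eq_bigr => i _; rewrite [LHS]linearZ.
under eq_bigr => i _ do rewrite IH scaler_sumr.
rewrite exchange_big /=; apply: eq_bigr => i _.
by rewrite scaler_sumr; apply: eq_bigr => j _; rewrite !scalerA mulrC.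
Qed.

Lemma extend_linear psi t : linear (fun a => extend_scalars psi (a :: t)).
Proof.
move=> d u v /=; rewrite scaler_sumr -big_split /=.
by apply: eq_bigr => i _; rewrite c'L scalerDl scalerA.
Qed.

Lemma extend_mlin psi : mlin (extend_scalars psi).
Proof.
move=> s t; elim: s psi => [|b s IH] psi; first exact: extend_linear.
move=> d u v /=; rewrite scaler_sumr -big_split /=.
by apply: eq_bigr => i _; rewrite IH scalerDr !scalerA mulrC.
Qed.

Lemma extend_iota psi a t : mlin psi ->
  extend_scalars psi (iA a :: t) = extend_scalars (fun u => psi (a :: u)) t.
Proof.
move=> pM /=; under eq_bigr => i _ do rewrite c'E.
rewrite -(extend_lincomb _ (fun i => c i a) (fun i u => psi (e i :: u))).
apply: eq_extend => u; rewrite [in RHS](cE a) (lin_sum (pM [::] u)).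
by apply: eq_bigr => i _; rewrite (linZ (pM [::] u)).
Qed.

Lemma extend_map psi s : mlin psi -> extend_scalars psi (map iA s) = iN (psi s).
Proof.
elim: s psi => [|a t IH] psi pM //.
by rewrite map_cons extend_iota // IH //; apply: mlin_cons.
Qed.

Lemma extend_degr psi q : base_change iN -> mlin psi -> degr q psi ->
  degr q (extend_scalars psi).
Proof.
move=> bcN pM pd ds s; elim: s ds q psi pM pd => [|a t IH] [|d ds] q psi pM pd //.
  move=> _; apply: (base_change_homog bcN); exact: (pd [::] [::] I).
move=> [ha ht]; have [L [hL ->]] := base_change_homog_span bcA fpA ha.
rewrite (lin_sum (extend_linear psi t)); apply: homog_sum => p pL.
rewrite (linZ (extend_linear psi t)); apply: homogZ; rewrite extend_iota //.
have := IH ds _ _ (mlin_cons p.2 pM) (degr_cons pd (hL p pL)) ht.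
by rewrite sum_cons /=; congr homog; lia.
Qed.

End Ext.

Lemma family_base_change (M N : gradedModule R) (M' N' : gradedModule K)
    (iM : {linear M -> M' | phi \; *:%R}) (iN : {linear N -> N' | phi \; *:%R})
    q (f : M -> seq A -> N) :
  base_change iM -> finite_projective M -> base_change iN -> hom_family q f ->
  exists f' : M' -> seq A' -> N', hom_family q f' /\
    forall x s, iN (f x s) = f' (iM x) (map iA s).
Proof.
move=> bcM fpM bcN fH.
have [n [e [c [c' [c'L c'E cE _]]]]] := base_change_coords bcA fpA.
have [n1 [b [k [k' [k'L k'E kE _]]]]] := base_change_coords bcM fpM.
pose ext := extend_scalars iN e c'.
pose f' x s := \sum_i k' i x *: ext (f (b i)) s.
have f'L s : linear (f'^~ s).
  move=> a u v; rewrite /f' scaler_sumr -big_split /=.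
  by apply: eq_bigr => i _; rewrite k'L scalerDl scalerA.
have f'i x s : f' (iM x) s = ext (f x) s.
  rewrite /f'; under eq_bigr => i _ do rewrite k'E.
  rewrite -(extend_lincomb iN e c' _ (fun i => k i x) (fun i => f (b i))).
  apply: eq_extend => t; rewrite [in RHS](kE x) (lin_sum (hom_lin fH t)).
  by apply: eq_bigr => i _; rewrite (linZ (hom_lin fH t)).
exists f'; split; last first.
  by move=> x s; rewrite f'i /ext (extend_map iN c'E cE) //; apply: (hom_mlin fH).
split=> // [x s t a u v|d x hx ds s hs].
  rewrite /f' scaler_sumr -big_split /=; apply: eq_bigr => i _.
  by rewrite /ext (extend_mlin iN e c'L) scalerDr !scalerA mulrC.
have [L [hL ->]] := base_change_homog_span bcM fpM hx.
rewrite (lin_sum (f'L s)); apply: homog_sum => p pL.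
rewrite (linZ (f'L s)); apply: homogZ; rewrite f'i.
apply: (extend_degr c'L c'E cE) => //; first exact: (hom_mlin fH).
exact/(hom_degr fH)/hL.
Qed.

End Extension.

(** * Clearing denominators, and fibres *)

Lemma quasi_iso_bijective (R : comNzRingType) (A : gradedAlgebra R)
    (P Q : ainfModule A) (f : P -> seq A -> Q) :
  minimal P -> minimal Q -> (forall x, f x [::] = 0 -> x = 0) ->
  (forall y, exists x, f x [::] = y) -> quasi_iso f.
Proof.
move=> mP mQ fI fS; split=> [x _ [y fx]|y _].
  by exists 0; rewrite mP; apply: fI; rewrite fx mQ.
have [x fx] := fS y; exists x; split; first exact: mP.
by exists 0; rewrite mQ addr0.
Qed.

Lemma formal_intro (R : comNzRingType) (A : gradedAlgebra R) (M : ainfModule A)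
  (hM : minimal M) (g : M -> seq A -> M) :
  hom_family 0 g -> (forall x, g x [::] = x) ->
  (forall x s, defect (@am_op R A (M2 hM)) (@am_op R A M) g x s = 0) -> formal M.
Proof.
move=> gH g1 g0; exists hM, g; split; first exact/is_morphismP.
apply: quasi_iso_bijective => // [x|y]; first by rewrite g1.
by exists y; apply: g1.
Qed.

Section FibreFormal.
Variables (R K : comNzRingType) (phi : {rmorphism R -> K}).
Variables (A : gradedAlgebra R) (A' : gradedAlgebra K).
Variables (M : ainfModule A) (M' : ainfModule A').
Hypotheses (fpA : finite_projective A) (fpM : finite_projective M).
Variables (iA : {linear A -> A' | phi \; *:%R}) (iM : {linear M -> M' | phi \; *:%R}).
Hypotheses (bcA : base_change iA) (bcM : base_change iM).
Hypotheses (iAM : forall a b, iA (gmul a b) = gmul (iA a) (iA b)).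
Hypotheses (iMM : forall x s, iM (am_op x s) = am_op (iM x) (map iA s)).

Lemma base_change_minimal : minimal M -> minimal M'.
Proof.
move=> hM x; have [n [e [_ [c' [_ _ _ v'E]]]]] := base_change_coords bcM fpM.
have mL := hom_lin (am_op_hom_family M') [::].
rewrite (v'E x) (lin_sum mL) big1 // => i _.
by rewrite (linZ mL) -(iMM _ [::]) hM raddf0 scaler0.
Qed.

Lemma M2_compat (hM : minimal M) (hM' : minimal M') x s :
  iM (@am_op R A (M2 hM) x s) = @am_op K A' (M2 hM') (iM x) (map iA s).
Proof. by case: s => [|a [|b s]]; [exact: raddf0 | exact: iMM | exact: raddf0]. Qed.

Lemma formal_base_change (hM : minimal M) (g : M -> seq A -> M) :
  hom_family 0 g -> (forall x, g x [::] = x) ->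
  (forall x s, defect (@am_op R A (M2 hM)) (@am_op R A M) g x s = 0) -> formal M'.
Proof.
move=> gH g1 g0; have hM' := base_change_minimal hM.
have [g' [g'H gg']] := family_base_change bcA fpA bcM fpM bcM gH.
have g'D := hom_defect (am_op_hom_family (M2 hM')) (am_op_hom_family M') g'H.
have [n [e [_ [c' [_ _ _ v'E]]]]] := base_change_coords bcM fpM.
apply: (formal_intro (hM := hM') g'H) => [x|x s].
  rewrite (v'E x) (lin_sum (hom_lin g'H [::])).
  by apply: eq_bigr => i _; rewrite (linZ (hom_lin g'H [::])) -(gg' _ [::]) g1.
apply: (mlin_zero bcA fpA) (hom_mlin g'D x) _ s => s.
rewrite (v'E x) (lin_sum (hom_lin g'D _)) big1 // => i _.
rewrite (linZ (hom_lin g'D _)).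
by rewrite -(defect_compat iAM (@M2_compat hM hM') iMM gg') g0 raddf0 scaler0.
Qed.

End FibreFormal.

Section Denominators.
Variables (R : comNzRingType) (K : fieldType) (phi : {rmorphism R -> K}).
Hypothesis phi_frac : forall c : K, exists a b : R, phi b != 0 /\ c = phi a / phi b.
Hypothesis phi_inj : forall r, phi r = 0 -> r = 0.

Lemma base_change_inj (V : gradedModule R) (V' : gradedModule K)
    (iota : {linear V -> V' | phi \; *:%R}) :
  base_change iota -> finite_projective V -> forall v, iota v = 0 -> v = 0.
Proof.
move=> bc fp v iv.
have [n [e [c [c' [c'L c'E cE _]]]]] := base_change_coords bc fp.
rewrite [v]cE big1 // => i _; rewrite (phi_inj (r := c i v)) ?scale0r //.
by rewrite -c'E iv (@lin0 K V' K^o (c' i) (c'L i)).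
Qed.

(** The product of the individual denominators works. *)
Lemma common_denominator n (P : 'I_n -> R -> Prop) :
  (forall i r s, P i r -> P i (s * r)) ->
  (forall i, exists r, phi r != 0 /\ P i r) ->
  exists r, phi r != 0 /\ forall i, P i r.
Proof.
move=> PM /fin_all_exists[r rP]; exists (\prod_i r i); split.
  by rewrite rmorph_prod; apply/prodf_neq0 => i _; have [] := rP i.
by move=> i; rewrite (bigD1 i) //= mulrC; apply/PM; have [] := rP i.
Qed.

Variables (A : gradedAlgebra R) (A' : gradedAlgebra K).
Variables (M : gradedModule R) (M' : gradedModule K).
Variables (iA : {linear A -> A' | phi \; *:%R}) (iM : {linear M -> M' | phi \; *:%R}).
Hypotheses (bcA : base_change iA) (bcM : base_change iM).
Hypotheses (fpA : finite_projective A) (fpM : finite_projective M).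

(** The denominator [r] brings [v] back to the image of [M]. *)
Definition clears (r : R) (v : M') := exists y, iM y = phi r *: v.

Lemma clearsM r s v : clears r v -> clears (s * r) v.
Proof. by move=> [y yE]; exists (s *: y); rewrite linearZ /= yE scalerA rmorphM. Qed.

Lemma clears_sum r (I : Type) (l : seq I) (c : I -> R) (F : I -> M') :
  (forall i, clears r (F i)) -> clears r (\sum_(i <- l) phi (c i) *: F i).
Proof.
move=> h; elim: l => [|i l [y yE]].
  by exists 0; rewrite big_nil raddf0 scaler0.
have [z zE] := h i; exists (c i *: z + y).
by rewrite big_cons raddfD /= yE linearZ /= zE scalerDr !scalerA mulrC.
Qed.

(** By multilinearity it suffices to treat the finitely many tuples of
    generators, whose images have finitely many coordinates. *)
Lemma clear_denominators p (T : seq A' -> M') : mlin T ->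
  exists r, phi r != 0 /\ forall s, size s = p -> clears r (T (map iA s)).
Proof.
elim: p T => [|p IH] T TM.
  have [n [e [_ [c' [_ _ _ v'E]]]]] := base_change_coords bcM fpM.
  have [|i|r [r0 rP]] :=
    @common_denominator n (fun i r => clears r (c' i (T [::]) *: iM (e i))).
  - by move=> i r s; apply: clearsM.
  - have [a [b [b0 ->]]] := phi_frac (c' i (T [::])).
    exists b; split=> //; exists (a *: e i).
    by rewrite linearZ /= scalerA mulrCA divff // mulr1.
  exists r; split=> // s /size0nil -> /=; rewrite [T _]v'E.
  have [y yE] := clears_sum (index_enum 'I_n) (fun=> 1) rP.
  exists y; rewrite yE; congr (_ *: _); apply: eq_bigr => i _.
  by rewrite rmorph1 scale1r.
have [n [e [c [_ [_ _ cE _]]]]] := base_change_coords bcA fpA.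
have [|i|r [r0 rP]] := @common_denominator n
    (fun i r => forall s, size s = p -> clears r (T (iA (e i) :: map iA s))).
- by move=> i r s h t tp; apply/clearsM/h.
- exact: (IH (fun u => T (iA (e i) :: u)) (mlin_cons _ TM)).
exists r; split=> // [[|a s]] //= [sp].
rewrite (cE a) raddf_sum (lin_sum (TM [::] (map iA s))) /=.
have := clears_sum (index_enum 'I_n) (fun i => c i a) (fun i => rP i s sp).
congr (clears _ _); apply: eq_bigr => i _.
by rewrite linearZ /= (linZ (TM [::] (map iA s))).
Qed.

Lemma clear_family_denominators n (f : M' -> seq A' -> M') :
  (forall s, linear (f^~ s)) -> (forall x, mlin (f x)) ->
  exists r, phi r != 0 /\
    forall x s, (size s <= n)%N -> clears r (f (iM x) (map iA s)).
Proof.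
move=> fL fM.
have [|i|r [r0 rP]] := @common_denominator n.+1 (fun i r =>
    forall x s, size s = i -> clears r (f (iM x) (map iA s))).
- by move=> i r s h x t tp; apply/clearsM/h.
- have [m [e [c [_ [_ _ cE _]]]]] := base_change_coords bcM fpM.
  have [|j|r [r0 rP]] := @common_denominator m (fun j r =>
    forall s, size s = i -> clears r (f (iM (e j)) (map iA s))).
  + by move=> j r s h t tp; apply/clearsM/h.
  + exact: clear_denominators.
  exists r; split=> // x s si.
  rewrite (cE x) raddf_sum (lin_sum (fL _)).
  have := clears_sum (index_enum 'I_m) (fun j => c j x) (fun j => rP j s si).
  congr (clears _ _); apply: eq_bigr => j _.
  by rewrite /= linearZ /= (linZ (fL _)).
exists r; split=> // x s sn.
exact: (rP (Ordinal (sn : (size s < n.+1)%N))).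
Qed.

Lemma family_descent q (f : M' -> seq A' -> M') : hom_family q f ->
  (forall x s, exists y, iM y = f (iM x) (map iA s)) ->
  exists g : M -> seq A -> M, hom_family q g /\
    forall x s, iM (g x s) = f (iM x) (map iA s).
Proof.
move=> fH ex.
pose g x s := sval (constructive_indefinite_description _ (ex x s)).
have gE x s : iM (g x s) = f (iM x) (map iA s).
  by rewrite /g; case: constructive_indefinite_description.
have iI u v : iM u = iM v -> u = v.
  move=> e; apply/eqP; rewrite -subr_eq0; apply/eqP.
  by apply: (base_change_inj bcM fpM); rewrite raddfB /= e subrr.
exists g; split=> //; split=> [s c u v|x s t c u v|d x hx ds s hs].
- by apply: iI; rewrite linearP /= !gE linearP /= (hom_lin fH).
- apply: iI; rewrite linearP /= !gE !map_cat /= linearP /=.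
  exact: (hom_mlin fH).
- apply: (@homog_descent R K M M' iM).
  + exact: raddfD.
  + exact: (base_change_inj bcM fpM).
  + exact: (base_change_homog bcM).
  rewrite gE; have := hom_degr fH (base_change_homog bcM hx) (s := map iA s) (ds := ds).
  rewrite size_map; apply.
  elim: s ds hs => [|a s IH] [|e ds] //= [ha hs]; split; last exact: IH.
  exact: (base_change_homog bcA).
Qed.

End Denominators.

(** [G] is a multiple of a normalized formality morphism of the fibre; it is cut
    off above arity [n], since a common denominator exists only for finitely
    many components. *)
Lemma generic_formal_approx (R : comNzRingType) (K : fieldType)
  (phi : {rmorphism R -> K})
  (phi_frac : forall c : K, exists a b : R, phi b != 0 /\ c = phi a / phi b)
  (phi_inj : forall r, phi r = 0 -> r = 0)
  (A : gradedAlgebra R) (A' : gradedAlgebra K)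
  (M : ainfModule A) (M' : ainfModule A') (hM : minimal M)
  (fpA : finite_projective A) (fpM : finite_projective M) :
  ainf_base_change phi M M' -> formal M' ->
  forall n : nat, exists (r : R) (G : M -> seq A -> M),
    [/\ r != 0, hom_family 0 G, forall x, G x [::] = r *: x
      & forall x s, (size s <= n)%N ->
          defect (@am_op R A (M2 hM)) (@am_op R A M) G x s = 0].
Proof.
move=> [iA [iM [bcA bcM iAM iMM]]] /formal_normalize[hM' [g [gH g1 g0]]] n.
have [r [r0 rP]] := clear_family_denominators phi_frac bcA bcM fpA fpM n
  (hom_lin gH) (hom_mlin gH).
pose H := trunc (fun k => k <= n)%N (fun x s => phi r *: g x s).
have HH : hom_family 0 H.
  have rgH : hom_family 0 (fun x s => phi r *: g x s).
    apply: eq_hom_family (hom_family_comb (phi r - 1) gH gH) => x s.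
    by rewrite scalerBl scale1r subrK.
  by apply: hom_trunc => k _; move/hom_familyP: rgH; apply.
have [|G [GH GE]] := family_descent phi_inj bcA bcM fpM HH.
  move=> x s; rewrite /H /trunc size_map; case: leqP => [sn|_]; first exact: rP.
  by exists 0; rewrite raddf0.
have iI := base_change_inj phi_inj bcM fpM.
exists r, G; split=> //.
- by apply: contraNneq r0 => ->; rewrite rmorph0.
- move=> x; apply/eqP; rewrite -subr_eq0; apply/eqP/iI.
  by rewrite raddfB /= linearZ /= GE /H /trunc /= g1 subrr.
move=> x s sn; apply: iI.
rewrite (defect_compat iAM (M2_compat iMM hM') iMM GE).
(* [defect_linear] speaks of combinations [c *: f + g], hence this form. *)
rewrite (eq_defect _ _ (g := fun y t => (phi r - 1) *: g y t + g y t)); last first.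
  move=> y t; rewrite size_map => ts.
  by rewrite /H /trunc (leq_trans ts sn) scalerBl scale1r subrK.
rewrite defect_linear; last exact: (hom_lin (am_op_hom_family M')).
by rewrite !g0 scaler0 addr0.
Qed.

Theorem proposition1p8p4
  (k : fieldType) (char_k : [pchar k] =i pred0)
  (R : idomainType) (k_to_R : {rmorphism k -> R})
  (A : gradedAlgebra R) (M : ainfModule A) (hM : minimal M)
  (fpA : finite_projective A) (fpM : finite_projective M)
  (tfHH : forall n : nat, HH_torsion_free (m2_gam hM) n (1 - n%:Z))
  (A_eta : gradedAlgebra {fraction R}) (M_eta : ainfModule A_eta)
  (fibre_eta : ainf_base_change (@tofrac R : {rmorphism R -> {fraction R}})
    M M_eta)
  (formal_eta : formal M_eta) :
  [/\ formal M,
      exists f : M -> seq A -> M2 hM,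
        [/\ is_morphism f, quasi_iso f & forall x, f x [::] = x]
    & forall (P : prime_idealr R) (kP : fieldType) (phi : {rmorphism R -> kP}),
        is_residue_field P phi ->
        forall (A_P : gradedAlgebra kP) (M_P : ainfModule A_P),
          ainf_base_change phi M M_P -> formal M_P].
Proof.
have frac_inj (r : R) : tofrac r = 0 -> r = 0.
  by move=> /eqP; rewrite tofrac_eq0 => /eqP.
have approx := generic_formal_approx (@fraction_quotient R) frac_inj hM fpA fpM
  fibre_eta formal_eta.
have [f [fH f1 f0]] := exists_to_M2 tfHH approx.
have [g [gH g1 fg]] := family_inverse fH f1.
have g0 : forall x s, defect (@am_op R A (M2 hM)) (@am_op R A M) g x s = 0.
  apply: (inverse_defect (hom_lin fH) _ _ fg f0).
    exact: (hom_lin (am_op_hom_family (M2 hM))).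
  by move=> x; rewrite f1.
split.
- exact: formal_intro gH g1 g0.
- exists f; split=> //; first exact/is_morphismP.
  by apply: quasi_iso_bijective => // [x|y]; [rewrite f1 | exists y].
- move=> P kP phi _ A_P M_P [iA [iM [bcA bcM iAM iMM]]].
  exact: (formal_base_change fpA fpM bcA bcM iAM iMM gH g1 g0).
Qed.
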